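(* Let $\beta\in\mathbb{C}$ with $|\beta|=1$ and $\beta^n\neq1$ for all $n\in\mathbb{N}$. Let $m\in\mathrm{Hol}(\mathbb{D})$ with $m(z)\neq0$ for all $z\in\mathbb{D}$, write $m=\exp(m_1)$ with $m_1\in\mathrm{Hol}(\mathbb{D})$, $m_1(z)=\sum_{n\geq0}a_nz^n$, and let $T:\mathrm{Hol}(\mathbb{D})\to\mathrm{Hol}(\mathbb{D})$ be given by $(Tf)(z)=m(z)f(\beta z)$. (a) If $\limsup_{n\to\infty}\left(\frac{|a_n|}{|1-\beta^n|}\right)^{1/n}\leq1$, then $\sigma_p(T)=\{m(0)\beta^n:n\in\mathbb{N}_0\}$, and for each $n\in\mathbb{N}_0$, $\ker(T-m(0)\beta^n\mathrm{Id})$ is one-dimensional, generated by $f_n(z)=z^n\exp(g_1(z))$ where $g_1(z)=\sum_{k\geq1}\frac{a_k}{1-\beta^k}z^k$, $z\in\mathbb{D}$. (b) If $\limsup_{n\to\infty}\left(\frac{|a_n|}{|1-\beta^n|}\right)^{1/n}>1$, then $\sigma_p(T)=\emptyset$.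
   Context: $\mathbb{D}$ is the open unit disc, $\mathrm{Hol}(\mathbb{D})$ the Fréchet space of holomorphic functions on $\mathbb{D}$, $\mathbb{N}_0=\mathbb{N}\cup\{0\}$. $\sigma_p(T)$ is the set of $\lambda\in\mathbb{C}$ such that $\lambda\mathrm{Id}-T$ is not injective. *)

(* Defs.v *)
From Stdlib Require Import Reals.
From Coquelicot Require Import Coquelicot.

Local Open Scope R_scope.

(* complex numbers of Coquelicot (avoid the clash with Stdlib's binomial C) *)
Notation CC := Coquelicot.Complex.C.

Definition inD (z : CC) : Prop := Cmod z < 1.

(* f : C -> C is holomorphic on the unit disc (complex differentiable at every
   point of D).  Elements of Hol(D) are represented by total functions, two
   functions being identified when they agree on D. *)
Definition Hol (f : CC -> CC) : Prop :=
  forall z, inD z -> ex_derive (K := C_AbsRing) (V := C_NormedModule) f z.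

Definition cexp (z : CC) : CC :=
  (exp (fst z) * cos (snd z), exp (fst z) * sin (snd z)).

Definition Cpseries (a : nat -> CC) (z l : CC) : Prop :=
  is_pseries (K := C_AbsRing) (V := C_NormedModule) a z l.

Definition Top (m : CC -> CC) (beta : CC) (f : CC -> CC) : CC -> CC :=
  fun z => Cmult (m z) (f (Cmult beta z)).

Definition point_spectrum (T : (CC -> CC) -> (CC -> CC)) (lam : CC) : Prop :=
  exists f g : CC -> CC, Hol f /\ Hol g /\
    (exists z, inD z /\ f z <> g z) /\
    (forall z, inD z ->
       Cminus (Cmult lam (f z)) (T f z) = Cminus (Cmult lam (g z)) (T g z)).

Definition nroot (x : R) (n : nat) : R :=
  if Req_EM_T x 0 then 0 else Rpower x (/ INR n).

Definition root_seq (a : nat -> CC) (beta : CC) (n : nat) : R :=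
  nroot (Cmod (a n) / Cmod (Cminus (RtoC 1) (Cpow beta n))) n.

Definition g1_coef (a : nat -> CC) (beta : CC) (k : nat) : CC :=
  match k with
  | O => RtoC 0
  | _ => Cdiv (a k) (Cminus (RtoC 1) (Cpow beta k))
  end.

(* Main.v *)
Require Import Defs.
From Stdlib Require Import Reals Arith ZArith Lra Lia Psatz Classical ClassicalEpsilon.
From Coquelicot Require Import Coquelicot.

(** No Cauchy theory is used.  Cesaro means along an orbit of the rotation by [beta]
    replace Fourier coefficients: the mean of [beta^(-jk) P(beta^j z)] over [j] is
    [c_k z^k] for a power series [P = sum c_k z^k].

    Where [g1] converges, [h = f exp(-g1)] turns the eigenvalue equation into
    [h(beta z) = mu h(z)].  Because powers of [beta] accumulate at 1, differentiating
    [w |-> h(w z) h(z0) - h(w z0) h(z)] at [w = 1] along them gives [z h' = kappa h], so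
    [h(e^s) e^(-kappa s)] is constant on a half plane; the period [2 pi i] and boundedness
    at 0 force [kappa] to be a natural number, i.e. [h = c z^n].

    If [f] is an eigenfunction that is nonzero somewhere on the circle of radius [r], it
    vanishes nowhere on it, [ln |f|] is bounded there, and comparing means in
    [Re m1 = ln |lam| + ln |f| - ln |f (beta .)|] bounds [|a_k| r^k / |1 - beta^k|].  When
    the limsup exceeds 1, [f] must therefore vanish outside a disc of some radius [R < 1],
    taken minimal; inside it [f = c z^n exp(g1)].  As [Re g1] has mean [Re g1(0) = 0] on
    every orbit, [f] cannot tend uniformly to 0 at the circle of radius [R], although it
    vanishes on that circle. *)

(** * Finite sums, Cesaro means and series of complex numbers *)

Lemma Cmod_minus_sym (x y : CC) : Cmod (x - y) = Cmod (y - x).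
Proof. rewrite <- Cmod_opp. f_equal. ring. Qed.

Lemma Cmod_minus_triangle (x y : CC) : Cmod (x - y) <= Cmod x + Cmod y.
Proof. unfold Cminus. rewrite <- (Cmod_opp y). apply Cmod_triangle. Qed.

Lemma Cmod_triangle_inv (x y : CC) : Cmod x - Cmod y <= Cmod (x - y).
Proof.
pose proof (Cmod_triangle (x - y) y) as H.
replace (x - y + y)%C with x in H by ring. lra.
Qed.

Lemma Cmod_nat_mult (n : nat) (v : CC) : Cmod (INR n * v) = INR n * Cmod v.
Proof. rewrite Cmod_mult, Cmod_R, Rabs_pos_eq; [easy | apply pos_INR]. Qed.

Lemma Cmod_pow_unit (q : CC) (n : nat) : Cmod q = 1 -> Cmod (q ^ n) = 1.
Proof. intros H. rewrite Cmod_pow, H. apply pow1. Qed.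

Lemma im_le_Cmod (z : CC) : Rabs (Im z) <= Cmod z.
Proof. eapply Rle_trans; [| apply Rmax_Cmod]. apply Rmax_r. Qed.

Lemma Cmod_le_re_im (z : CC) : Cmod z <= Rabs (Re z) + Rabs (Im z).
Proof.
replace z with (Re z + Ci * Im z)%C at 1
  by (destruct z; apply injective_projections; simpl; ring).
eapply Rle_trans; [apply Cmod_triangle |].
rewrite Cmod_mult, Cmod_Ci, !Cmod_R. lra.
Qed.

Lemma Cminus_neq_0 (x y : CC) : x <> y -> (x - y)%C <> 0.
Proof. intros H E. apply H. replace x with (x - y + y)%C by ring. rewrite E. ring. Qed.

Lemma unit_conj_mult (q : CC) : Cmod q = 1 -> (q * Cconj q)%C = 1.
Proof. intros H. rewrite <- Cmod2_conj, H. f_equal. ring. Qed.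

Fixpoint csum (u : nat -> CC) (n : nat) : CC :=
  match n with O => 0 | S p => (csum u p + u p)%C end.

Lemma csum_ext (u v : nat -> CC) (n : nat) :
  (forall k, u k = v k) -> csum u n = csum v n.
Proof. intros H. induction n; simpl; [easy | now rewrite IHn, H]. Qed.

Lemma csum_plus (u v : nat -> CC) (n : nat) :
  csum (fun k => u k + v k)%C n = (csum u n + csum v n)%C.
Proof. induction n; simpl; [ring | rewrite IHn; ring]. Qed.

Lemma csum_scal (c : CC) (u : nat -> CC) (n : nat) :
  csum (fun k => c * u k)%C n = (c * csum u n)%C.
Proof. induction n; simpl; [ring | rewrite IHn; ring]. Qed.

Lemma csum_conj (u : nat -> CC) (n : nat) :
  csum (fun k => Cconj (u k)) n = Cconj (csum u n).
Proof.
induction n; simpl.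
- apply injective_projections; simpl; ring.
- now rewrite IHn, Cplus_conj.
Qed.

Lemma csum_const (c : CC) (n : nat) : csum (fun _ => c) n = (INR n * c)%C.
Proof.
induction n; [simpl; ring |].
rewrite S_INR, RtoC_plus. simpl csum. rewrite IHn. ring.
Qed.

Lemma csum_bound (u : nat -> CC) (B : R) (n : nat) :
  (forall k, Cmod (u k) <= B) -> Cmod (csum u n) <= INR n * B.
Proof.
intros H. induction n.
- simpl csum. rewrite Cmod_0. simpl. lra.
- rewrite S_INR. simpl csum.
  eapply Rle_trans; [apply Cmod_triangle |]. specialize (H n). lra.
Qed.

Lemma csum_telescope (u : nat -> CC) (n : nat) :
  csum (fun k => u k - u (S k))%C n = (u O - u n)%C.
Proof. induction n; simpl; [ring | rewrite IHn; ring]. Qed.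

Lemma csum_geom (q : CC) (n : nat) :
  ((1 - q) * csum (fun k => q ^ k) n)%C = (1 - q ^ n)%C.
Proof.
induction n; simpl; [ring |].
rewrite Cmult_plus_distr_l, IHn. ring.
Qed.

Lemma csum_geom_tail (u : nat -> CC) (M q : R) (N n : nat) :
  0 <= q < 1 -> (forall k, Cmod (u k) <= M * q ^ k) -> (N <= n)%nat ->
  Cmod (csum u n - csum u N) <= M * q ^ N / (1 - q).
Proof.
intros Hq Hu Hn.
assert (HM : 0 <= M).
{ pose proof (Hu O) as H. simpl in H. pose proof (Cmod_ge_0 (u O)). lra. }
(* The final bound is not inductive in [n]; the exact finite geometric sum is. *)
assert (H : Cmod (csum u n - csum u N) <= M * (q ^ N - q ^ n) / (1 - q)).
{ induction Hn as [| n Hn IH].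
  - replace (csum u N - csum u N)%C with (RtoC 0) by ring.
    rewrite Cmod_0. apply Req_le. field. lra.
  - simpl csum.
    replace (csum u n + u n - csum u N)%C with ((csum u n - csum u N) + u n)%C by ring.
    eapply Rle_trans; [apply Cmod_triangle |].
    specialize (Hu n).
    replace (M * (q ^ N - q ^ S n) / (1 - q))
      with (M * (q ^ N - q ^ n) / (1 - q) + M * q ^ n) by (simpl; field; lra).
    lra. }
eapply Rle_trans; [exact H |].
unfold Rdiv. apply Rmult_le_compat_r.
- apply Rlt_le, Rinv_0_lt_compat. lra.
- apply Rmult_le_compat_l; [easy |]. pose proof (pow_le q n (proj1 Hq)). lra.
Qed.

(** Convergence of the averages to [v], multiplied through by [n] so that no division occurs. *)
Definition mean (u : nat -> CC) (v : CC) : Prop :=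
  forall eps, 0 < eps -> exists N : nat, forall n, (N <= n)%nat ->
    Cmod (csum u n - INR n * v) <= eps * INR n.

Lemma mean_ext (u w : nat -> CC) (v : CC) :
  (forall k, u k = w k) -> mean u v -> mean w v.
Proof.
intros E H eps He. destruct (H eps He) as [N HN]. exists N. intros n Hn.
rewrite <- (csum_ext u w n E). auto.
Qed.

Lemma mean_plus (u u' : nat -> CC) (v v' : CC) :
  mean u v -> mean u' v' -> mean (fun k => u k + u' k)%C (v + v').
Proof.
intros H H' eps He.
destruct (H (eps / 2)) as [N HN]; [lra |].
destruct (H' (eps / 2)) as [N' HN']; [lra |].
exists (max N N'). intros n Hn. rewrite csum_plus.
replace (csum u n + csum u' n - INR n * (v + v'))%C
  with ((csum u n - INR n * v) + (csum u' n - INR n * v'))%C by ring.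
eapply Rle_trans; [apply Cmod_triangle |].
specialize (HN n ltac:(lia)). specialize (HN' n ltac:(lia)). lra.
Qed.

Lemma mean_scal (c : CC) (u : nat -> CC) (v : CC) :
  mean u v -> mean (fun k => c * u k)%C (c * v).
Proof.
intros H eps He. pose proof (Cmod_ge_0 c) as Hc.
destruct (H (eps / (Cmod c + 1))) as [N HN]; [apply Rdiv_lt_0_compat; lra |].
exists N. intros n Hn. rewrite csum_scal.
replace (c * csum u n - INR n * (c * v))%C
  with (c * (csum u n - INR n * v))%C by ring.
rewrite Cmod_mult. specialize (HN n Hn).
apply Rle_trans with (Cmod c * (eps / (Cmod c + 1) * INR n)).
- now apply Rmult_le_compat_l.
- replace (Cmod c * (eps / (Cmod c + 1) * INR n))
    with (Cmod c / (Cmod c + 1) * (eps * INR n)) by (field; lra).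
  rewrite <- (Rmult_1_l (eps * INR n)) at 2.
  apply Rmult_le_compat_r; [apply Rmult_le_pos; [lra | apply pos_INR] |].
  apply Rle_div_l; lra.
Qed.

Lemma mean_const (c : CC) : mean (fun _ => c) c.
Proof.
intros eps He. exists O. intros n _. rewrite csum_const.
replace (INR n * c - INR n * c)%C with (RtoC 0) by ring.
rewrite Cmod_0. apply Rmult_le_pos; [lra | apply pos_INR].
Qed.

Lemma mean_conj (u : nat -> CC) (v : CC) :
  mean u v -> mean (fun k => Cconj (u k)) (Cconj v).
Proof.
intros H eps He. destruct (H eps He) as [N HN]. exists N. intros n Hn.
rewrite csum_conj.
replace (Cconj (csum u n) - INR n * Cconj v)%C
  with (Cconj (csum u n - INR n * v)).
- rewrite Cmod_conj. auto.
- rewrite Cminus_conj, Cmult_conj. do 2 f_equal.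
  apply injective_projections; simpl; ring.
Qed.

Lemma mean_of_bounded_sums (u : nat -> CC) (B : R) :
  (forall n, Cmod (csum u n) <= B) -> mean u 0.
Proof.
intros H eps He. destruct (INR_unbounded (B / eps)) as [N HN].
exists N. intros n Hn.
replace (csum u n - INR n * 0)%C with (csum u n) by ring.
apply Rle_trans with B; [easy |].
apply le_INR in Hn.
replace B with (eps * (B / eps)) by (field; lra).
apply Rmult_le_compat_l; lra.
Qed.

Lemma mean_geom (q : CC) : Cmod q = 1 -> q <> 1 -> mean (fun j => q ^ j)%C 0.
Proof.
intros H1 Hq. assert (Hd : (1 - q)%C <> 0) by (apply Cminus_neq_0; congruence).
apply mean_of_bounded_sums with (2 / Cmod (1 - q)). intros n.
apply Rle_div_r; [now apply Cmod_gt_0 |].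
rewrite Rmult_comm, <- Cmod_mult, csum_geom.
eapply Rle_trans; [apply Cmod_minus_triangle |].
rewrite Cmod_1, Cmod_pow_unit by easy. lra.
Qed.

Lemma mean_csum (u : nat -> nat -> CC) (v : nat -> CC) (L : nat) :
  (forall l, mean (fun j => u j l) (v l)) ->
  mean (fun j => csum (u j) L) (csum v L).
Proof.
intros H. induction L; simpl; [apply mean_const |].
now apply (mean_plus (fun j => csum (u j) L) (fun j => u j L)).
Qed.

(** Approximation uniform in the index survives averaging. This reduces the mean of a power series
    along an orbit to that of a truncation, which is computed term by term. *)
Lemma mean_uniform_limit (u : nat -> CC) (v : CC) :
  (forall eps, 0 < eps -> exists u' v',
     (forall k, Cmod (u k - u' k) <= eps) /\ Cmod (v - v') <= eps /\ mean u' v') ->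
  mean u v.
Proof.
intros H eps He.
destruct (H (eps / 3)) as (u' & v' & Hu & Hv & Hm); [lra |].
destruct (Hm (eps / 3)) as [N HN]; [lra |]. exists N. intros n Hn.
specialize (HN n Hn).
pose proof (csum_bound (fun k => u k + (- (1)) * u' k)%C (eps / 3) n) as Hs.
rewrite csum_plus, csum_scal in Hs.
replace (csum u n - INR n * v)%C
  with ((csum u n + - (1) * csum u' n) + (csum u' n - INR n * v') + - (INR n * (v - v')))%C
  by ring.
eapply Rle_trans; [apply Cmod_triangle |].
eapply Rle_trans; [apply Rplus_le_compat_r, Cmod_triangle |].
rewrite Cmod_opp, Cmod_nat_mult.
assert (INR n * Cmod (v - v') <= INR n * (eps / 3))
  by (apply Rmult_le_compat_l; [apply pos_INR | easy]).
assert (Cmod (csum u n + - (1) * csum u' n) <= INR n * (eps / 3)).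
{ apply Hs. intros k. replace (u k + - (1) * u' k)%C with (u k - u' k)%C by ring. apply Hu. }
lra.
Qed.

Lemma mean_re_bound (u : nat -> CC) (v : CC) (B : R) :
  (forall k, Re (u k) <= B) -> mean u v -> Re v <= B.
Proof.
intros Hu H. apply le_epsilon. intros eps He.
destruct (H eps He) as [N HN]. specialize (HN (S N) ltac:(lia)).
assert (Hs : forall n, Re (csum u n) <= INR n * B).
{ intros n. induction n; [simpl; lra |]. rewrite S_INR. simpl csum.
  specialize (Hu n). unfold Re in *. simpl. lra. }
specialize (Hs (S N)).
assert (Hp : 0 < INR (S N)) by (apply lt_0_INR; lia).
pose proof (Rle_trans _ _ _ (re_le_Cmod _) HN) as HR.
apply Rabs_le_between in HR. destruct HR as [HR _].
replace (Re (csum u (S N) - INR (S N) * v)%C)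
  with (Re (csum u (S N)) - INR (S N) * Re v) in HR by (unfold Re; simpl; ring).
apply Rmult_le_reg_l with (INR (S N)); [easy |]. lra.
Qed.

Lemma mean_bound (u : nat -> CC) (v : CC) (B : R) :
  (forall k, Cmod (u k) <= B) -> mean u v -> Cmod v <= B.
Proof.
intros Hu H. apply le_epsilon. intros eps He.
destruct (H eps He) as [N HN]. specialize (HN (S N) ltac:(lia)).
pose proof (csum_bound u B (S N) Hu) as Hs.
assert (Hp : 0 < INR (S N)) by (apply lt_0_INR; lia).
apply Rmult_le_reg_l with (INR (S N)); [easy |].
rewrite <- Cmod_nat_mult.
replace (INR (S N) * v)%C
  with (csum u (S N) - (csum u (S N) - INR (S N) * v))%C by ring.
eapply Rle_trans; [apply Cmod_minus_triangle |]. lra.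
Qed.

(** * Convergent series *)

Definition cser (u : nat -> CC) (l : CC) : Prop :=
  forall eps, 0 < eps -> exists N : nat, forall n, (N <= n)%nat ->
    Cmod (csum u n - l) <= eps.

Lemma cser_ext (u w : nat -> CC) (l : CC) :
  (forall k, u k = w k) -> cser u l -> cser w l.
Proof.
intros E H eps He. destruct (H eps He) as [N HN]. exists N. intros n Hn.
rewrite <- (csum_ext u w n E). auto.
Qed.

Lemma cser_plus (u u' : nat -> CC) (l l' : CC) :
  cser u l -> cser u' l' -> cser (fun k => u k + u' k)%C (l + l').
Proof.
intros H H' eps He.
destruct (H (eps / 2)) as [N HN]; [lra |].
destruct (H' (eps / 2)) as [N' HN']; [lra |].
exists (max N N'). intros n Hn. rewrite csum_plus.
replace (csum u n + csum u' n - (l + l'))%C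
  with ((csum u n - l) + (csum u' n - l'))%C by ring.
eapply Rle_trans; [apply Cmod_triangle |].
specialize (HN n ltac:(lia)). specialize (HN' n ltac:(lia)). lra.
Qed.

Lemma cser_scal (c : CC) (u : nat -> CC) (l : CC) :
  cser u l -> cser (fun k => c * u k)%C (c * l).
Proof.
intros H eps He. pose proof (Cmod_ge_0 c) as Hc.
destruct (H (eps / (Cmod c + 1))) as [N HN]; [apply Rdiv_lt_0_compat; lra |].
exists N. intros n Hn. rewrite csum_scal.
replace (c * csum u n - c * l)%C with (c * (csum u n - l))%C by ring.
rewrite Cmod_mult. specialize (HN n Hn).
apply Rle_trans with (Cmod c * (eps / (Cmod c + 1))).
- now apply Rmult_le_compat_l.
- replace (Cmod c * (eps / (Cmod c + 1)))
    with (Cmod c / (Cmod c + 1) * eps) by (field; lra).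
  rewrite <- (Rmult_1_l eps) at 2.
  apply Rmult_le_compat_r; [lra |]. apply Rle_div_l; lra.
Qed.

Lemma cser_bound (u : nat -> CC) (l c : CC) (B : R) (N : nat) :
  cser u l -> (forall n, (N <= n)%nat -> Cmod (csum u n - c) <= B) -> Cmod (l - c) <= B.
Proof.
intros H Hu. apply le_epsilon. intros eps He.
destruct (H eps He) as [N' HN].
specialize (HN (max N N') ltac:(lia)). specialize (Hu (max N N') ltac:(lia)).
replace (l - c)%C
  with ((csum u (max N N') - c) - (csum u (max N N') - l))%C by ring.
eapply Rle_trans; [apply Cmod_minus_triangle |]. lra.
Qed.

Lemma cser_unique (u : nat -> CC) (l l' : CC) : cser u l -> cser u l' -> l = l'.
Proof.
intros H H'.
assert (E : Cmod (l - l') <= 0).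
{ apply le_epsilon. intros eps He. rewrite Rplus_0_l.
  destruct (H' eps He) as [N HN]. now apply cser_bound with u N. }
assert (Z : (l - l')%C = 0) by (apply Cmod_eq_0; pose proof (Cmod_ge_0 (l - l')); lra).
replace l with (l - l' + l')%C by ring. rewrite Z. ring.
Qed.

Lemma cser_tail (u : nat -> CC) (l : CC) (M q : R) (N : nat) :
  0 <= q < 1 -> (forall k, Cmod (u k) <= M * q ^ k) -> cser u l ->
  Cmod (l - csum u N) <= M * q ^ N / (1 - q).
Proof.
intros Hq Hu H. apply cser_bound with u N; [easy |].
intros n Hn. now apply csum_geom_tail.
Qed.

Lemma bounded_of_eventually (v : nat -> R) (B : R) (N : nat) :
  (forall k, (N <= k)%nat -> v k <= B) -> exists M, forall k, v k <= M.
Proof.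
revert B. induction N as [| N IH]; intros B H.
- exists B. intros k. apply H. lia.
- apply (IH (Rmax B (v N))). intros k Hk.
  destruct (Nat.eq_dec k N) as [-> |]; [apply Rmax_r |].
  eapply Rle_trans; [apply H; lia | apply Rmax_l].
Qed.

Lemma cser_terms_bounded (u : nat -> CC) (l : CC) :
  cser u l -> exists M, forall k, Cmod (u k) <= M.
Proof.
intros H. destruct (H 1 Rlt_0_1) as [N HN].
apply (bounded_of_eventually _ 2 N). intros k Hk.
replace (u k) with ((csum u (S k) - l) - (csum u k - l))%C by (simpl; ring).
eapply Rle_trans; [apply Cmod_minus_triangle |].
pose proof (HN k Hk). pose proof (HN (S k) ltac:(lia)). lra.
Qed.

Lemma sum_n_csum (u : nat -> CC) (n : nat) :
  sum_n (G := C_AbelianMonoid) u n = csum u (S n).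
Proof.
induction n.
- rewrite sum_O. simpl. ring.
- rewrite sum_Sn, IHn. reflexivity.
Qed.

(** [sum_n u n] has [n + 1] terms and [csum u n] has [n], hence the shifts; halving [eps] turns the
    non-strict inequality into a strict one. *)
Lemma is_series_cser (u : nat -> CC) (l : CC) :
  is_series (K := C_AbsRing) (V := C_NormedModule) u l <-> cser u l.
Proof.
unfold is_series. 
rewrite (filterlim_locally_ball_norm (K := C_AbsRing) (U := C_NormedModule) (F := eventually)).
split; intros H.
- intros eps He. destruct (H (mkposreal eps He)) as [N HN]. exists (S N).
  intros [| n] Hn; [lia |]. specialize (HN n ltac:(lia)).
  rewrite <- sum_n_csum. apply Rlt_le. exact HN.
- intros eps. destruct (H (eps / 2)) as [N HN]; [destruct eps; simpl; lra |].
  exists N. intros n Hn. specialize (HN (S n) ltac:(lia)).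
  rewrite <- sum_n_csum in HN. destruct eps as [e He]. simpl in *.
  apply Rle_lt_trans with (e / 2); [exact HN | lra].
Qed.

Lemma Cpseries_cser (a : nat -> CC) (z l : CC) :
  Cpseries a z l <-> cser (fun k => a k * z ^ k)%C l.
Proof.
unfold Cpseries, is_pseries. rewrite is_series_cser.
assert (E : forall k, scal (K := C_AbsRing) (V := C_NormedModule)
   (pow_n (K := C_AbsRing) z k) (a k) = (a k * z ^ k)%C).
{ intros k. exact (Cmult_comm (z ^ k) (a k)). }
split; apply cser_ext; intros k; now rewrite E.
Qed.

Lemma cser_exists (u : nat -> CC) (M q : R) :
  0 <= q < 1 -> (forall k, Cmod (u k) <= M * q ^ k) -> exists l, cser u l.
Proof.
intros Hq Hu.
destruct (ex_series_le (K := C_AbsRing) (V := C_CompleteNormedModule) u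
  (fun k => scal M (q ^ k))) as [l Hl].
- exact Hu.
- apply (ex_series_scal (K := R_AbsRing) (V := R_NormedModule)).
  apply ex_series_geom. rewrite Rabs_pos_eq; lra.
- exists l. now apply is_series_cser.
Qed.

(** * Irrational rotations *)

(** The condition [k < N] keeps the distinguished term [k] inside the truncation made in
    [mean_pseries]. *)
Lemma geom_small (M s eps : R) (k : nat) :
  0 <= s < 1 -> 0 < eps -> exists N, (k < N)%nat /\ M * s ^ N / (1 - s) <= eps.
Proof.
intros Hs He.
assert (HM : 0 < Rabs M + 1) by (pose proof (Rabs_pos M); lra).
destruct (pow_lt_1_zero s) with (y := eps * (1 - s) / (Rabs M + 1)) as [N HN].
- rewrite Rabs_pos_eq; lra.
- apply Rdiv_lt_0_compat; [apply Rmult_lt_0_compat; lra | easy].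
- exists (N + S k)%nat. split; [lia |].
  specialize (HN (N + S k)%nat ltac:(lia)).
  apply Rle_div_l; [lra |].
  pose proof (pow_le s (N + S k) (proj1 Hs)) as Hp.
  rewrite Rabs_pos_eq in HN by easy.
  apply Rlt_div_r in HN; [| lra].
  pose proof (Rle_abs M). nra.
Qed.

Lemma csum_single (v : CC) (k n : nat) :
  csum (fun l => if Nat.eq_dec l k then v else 0) n = if le_dec n k then RtoC 0 else v.
Proof.
induction n as [| n IH]; simpl csum; [destruct le_dec; [easy | lia] |].
rewrite IH. destruct (le_dec n k), (le_dec (S n) k), (Nat.eq_dec n k); try lia; ring.
Qed.

(** The term of index [l] contributes the mean of the powers of [q beta^l], which is 0 when this
    unimodular number is not 1. Only the index [k] may resonate; the mean there is left as a
    parameter [e], equal to 1 at a resonance and to 0 otherwise. *)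
Lemma mean_pseries (beta q z e : CC) (c p : nat -> CC) (M s : R) (k : nat) :
  Cmod beta = 1 -> Cmod q = 1 -> 0 <= s < 1 ->
  (forall l, Cmod (c l * z ^ l) <= M * s ^ l) ->
  (forall j, cser (fun l => c l * (beta ^ j * z) ^ l)%C (p j)) ->
  (forall l, l <> k -> (q * beta ^ l)%C <> 1) ->
  mean (fun j => (q * beta ^ k) ^ j)%C e ->
  mean (fun j => q ^ j * p j)%C (c k * z ^ k * e).
Proof.
intros Hb Hq Hs Hc Hp Hres He.
apply mean_uniform_limit. intros eps Heps.
destruct (geom_small M s eps k Hs Heps) as (N & HN & HNe).
exists (fun j => csum (fun l => (c l * z ^ l) * (q * beta ^ l) ^ j) N)%C, (c k * z ^ k * e)%C.
repeat split.
(* The truncation error is a geometric tail, uniform in [j] because multiplication by [beta^j]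
   preserves moduli. *)
- intros j.
  replace (csum (fun l => (c l * z ^ l) * (q * beta ^ l) ^ j)%C N)
    with (q ^ j * csum (fun l => c l * (beta ^ j * z) ^ l) N)%C.
  + replace (q ^ j * p j - q ^ j * csum (fun l => c l * (beta ^ j * z) ^ l) N)%C
      with (q ^ j * (p j - csum (fun l => c l * (beta ^ j * z) ^ l) N))%C by ring.
    rewrite Cmod_mult, Cmod_pow_unit, Rmult_1_l by easy.
    apply Rle_trans with (M * s ^ N / (1 - s)); [| easy].
    apply cser_tail; [easy | | apply Hp].
    intros l. eapply Rle_trans; [| apply Hc].
    rewrite Cpow_mult_l, !Cmod_mult, (Cmod_pow_unit (beta ^ j)) by now apply Cmod_pow_unit.
    lra.
  + rewrite <- csum_scal. apply csum_ext. intros l.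
    rewrite !Cpow_mult_l, <- !Cpow_mult_r, (Nat.mul_comm j l). ring.
- replace (c k * z ^ k * e - c k * z ^ k * e)%C with (RtoC 0) by ring.
  rewrite Cmod_0. lra.
- replace (c k * z ^ k * e)%C
    with (csum (fun l => if Nat.eq_dec l k then c k * z ^ k * e else 0) N)%C
    by (rewrite csum_single; destruct le_dec; [lia | easy]).
  apply (mean_csum (fun j l => c l * z ^ l * (q * beta ^ l) ^ j)%C).
  intros l. destruct (Nat.eq_dec l k) as [-> | Hl].
  + now apply mean_scal.
  + replace (RtoC 0) with (c l * z ^ l * 0)%C by ring.
    apply mean_scal, mean_geom; [| now apply Hres].
    rewrite Cmod_mult, Hq, Cmod_pow_unit by easy. lra.
Qed.

Definition irrational_rotation (beta : CC) : Prop :=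
  Cmod beta = 1 /\ forall n : nat, (1 <= n)%nat -> (beta ^ n)%C <> 1.

Lemma cser_geom (x : CC) : Cmod x < 1 -> cser (fun l => x ^ l)%C (/ (1 - x)).
Proof.
intros Hx.
destruct (cser_exists (fun l => x ^ l)%C 1 (Cmod x)) as [l Hl].
- split; [apply Cmod_ge_0 | easy].
- intros k. rewrite Cmod_pow. lra.
- assert (Hne : (1 - x)%C <> 0).
  { apply Cminus_neq_0. intros E. rewrite <- E, Cmod_1 in Hx. lra. }
  assert (El : ((1 - x) * l)%C = 1).
  { apply (cser_unique (fun k => (1 - x) * x ^ k)%C); [now apply cser_scal |].
    intros eps He.
    destruct (pow_lt_1_zero (Cmod x)) with (y := eps) as [N HN]; [| easy |].
    - rewrite Rabs_pos_eq; [easy | apply Cmod_ge_0].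
    - exists N. intros n Hn. rewrite csum_scal, csum_geom.
      replace (1 - x ^ n - 1)%C with (- x ^ n)%C by ring.
      rewrite Cmod_opp, Cmod_pow.
      eapply Rle_trans; [apply Rle_abs |]. apply Rlt_le, HN, Hn. }
  replace (/ (1 - x))%C with l; [easy |].
  transitivity ((1 - x) * l * / (1 - x))%C; [field; exact Hne | rewrite El; ring].
Qed.

(* The Poisson kernel at radius [rho] has mean 1 along the orbit, but is small away
   from [w] when [rho] is close to 1. *)
Lemma orbit_dense (beta w : CC) (eps : R) :
  irrational_rotation beta -> Cmod w = 1 -> 0 < eps ->
  exists n : nat, Cmod (beta ^ n - w) < eps.
Proof.
intros [Hb Hirr] Hw He. apply NNPP. intros Hno.
assert (Hfar : forall n, eps <= Cmod (beta ^ n - w)).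
{ intros n. apply Rnot_lt_le. intros Hn. apply Hno. now exists n. }
(* [d <= eps / 2] keeps the denominator [1 - x beta^j] at least [eps / 2] in modulus;
   [d <= eps^2 / 16] then brings the real part of its inverse down to 3/4. *)
set (d := Rmin (1 / 2) (Rmin (eps / 2) (eps * eps / 16))).
assert (Hd : 0 < d /\ d <= 1 / 2 /\ d <= eps / 2 /\ d <= eps * eps / 16).
{ unfold d. repeat split.
  - repeat apply Rmin_glb_lt; nra.
  - apply Rmin_l.
  - eapply Rle_trans; [apply Rmin_r | apply Rmin_l].
  - eapply Rle_trans; [apply Rmin_r | apply Rmin_r]. }
set (x := ((1 - d)%R * Cconj w)%C).
assert (Hx : Cmod x = 1 - d).
{ unfold x. rewrite Cmod_mult, Cmod_conj, Hw, Cmod_R, Rabs_pos_eq; lra. }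
(* The real part of [p j] is half of 1 plus the Poisson kernel. As a geometric series [p] has
   constant term 1, and its other terms have mean zero. *)
set (p := fun j => (/ (1 - x * beta ^ j))%C).
assert (Hm : mean (fun j => 1 ^ j * p j)%C (x ^ 0 * 1 ^ 0 * 1)).
{ apply (mean_pseries beta 1 1 1 (fun l => x ^ l)%C p 1 (Cmod x)).
  - easy.
  - apply Cmod_1.
  - lra.
  - intros l. rewrite Cpow_1_l, Cmult_1_r, Cmod_pow. lra.
  - intros j. apply cser_ext with (fun l => (x * beta ^ j) ^ l)%C.
    + intros l. rewrite Cmult_1_r, Cpow_mult_l. easy.
    + apply cser_geom. rewrite Cmod_mult, Cmod_pow_unit by easy. lra.
  - intros l Hl. rewrite Cmult_1_l. apply Hirr. lia.
  - apply mean_ext with (fun _ => RtoC 1); [| apply mean_const].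
    intros j. simpl (beta ^ 0)%C. rewrite Cmult_1_l, Cpow_1_l. easy. }
apply (mean_re_bound _ _ (3 / 4)) in Hm.
- replace (x ^ 0 * 1 ^ 0 * 1)%C with (RtoC 1) in Hm by (simpl; ring).
  unfold Re in Hm; simpl in Hm. lra.
- intros j. rewrite Cpow_1_l, Cmult_1_l. unfold p.
  set (D := (1 - x * beta ^ j)%C).
  assert (HD : eps / 2 <= Cmod D).
  { replace (Cmod D) with (Cmod (w - (1 - d)%R * beta ^ j)).
    - replace (w - (1 - d)%R * beta ^ j)%C with (- ((beta ^ j - w) - d * beta ^ j))%C
        by (rewrite RtoC_minus; ring).
      rewrite Cmod_opp. eapply Rle_trans; [| apply Cmod_triangle_inv].
      rewrite Cmod_mult, Cmod_R, Cmod_pow_unit, Rabs_pos_eq by (easy || lra).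
      specialize (Hfar j). lra.
    - replace (w - (1 - d)%R * beta ^ j)%C with (w * D)%C.
      + rewrite Cmod_mult, Hw. lra.
      + unfold D, x. pose proof (unit_conj_mult w Hw) as E.
        replace (w * (1 - (1 - d)%R * Cconj w * beta ^ j))%C
          with (w - (1 - d)%R * (w * Cconj w) * beta ^ j)%C by ring.
        rewrite E. ring. }
  assert (H1 : Cmod (1 - D) = 1 - d).
  { replace (1 - D)%C with (x * beta ^ j)%C by (unfold D; ring).
    rewrite Cmod_mult, Hx, Cmod_pow_unit by easy. lra. }
  (* Comparing [|D|^2] with [|1 - D|^2 = (1 - d)^2] gives Re (1/D) = 1/2 + (2d - d^2) / (2 |D|^2),
     hence at most 1/2 + 1/4. *)
  pose proof (Cmod2_alt D) as E1. pose proof (Cmod2_alt (1 - D)) as E2.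
  rewrite H1 in E2. clearbody D. destruct D as [a b]. unfold Re, Im in *. simpl in *.
  assert (HC : eps * eps / 4 <= Cmod (a, b) * Cmod (a, b)) by nra.
  assert (0 < a * (a * 1) + b * (b * 1)) by nra.
  apply Rle_div_l; [easy |]. nra.
Qed.

(** Density at 1 could be witnessed by the exponent 0. Approaching the inverse of [beta] and taking
    one more step makes the exponent positive. *)
Lemma orbit_returns (beta : CC) (eps : R) :
  irrational_rotation beta -> 0 < eps ->
  exists n : nat, (1 <= n)%nat /\ Cmod (beta ^ n - 1) < eps.
Proof.
intros Hb He. destruct (orbit_dense beta (Cconj beta) eps Hb) as [n Hn]; [| easy |].
- rewrite Cmod_conj. apply Hb.
- exists (S n). split; [lia |].
  replace (beta ^ S n - 1)%C with (beta * (beta ^ n - Cconj beta))%C.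
  + rewrite Cmod_mult, (proj1 Hb). lra.
  + rewrite <- (unit_conj_mult beta (proj1 Hb)). simpl. ring.
Qed.

Lemma rotation_pow_inj (beta : CC) (n k : nat) :
  irrational_rotation beta -> (beta ^ n)%C = (beta ^ k)%C -> n = k.
Proof.
intros [Hb Hirr].
assert (Hlt : forall n k, (n < k)%nat -> (beta ^ n)%C <> (beta ^ k)%C).
{ intros i j Hij E. apply (Hirr (j - i)%nat); [lia |].
  replace j with (i + (j - i))%nat in E by lia.
  rewrite Cpow_add_r in E.
  assert (Hn : (beta ^ i)%C <> 0).
  { apply Cpow_nz. intros E0. rewrite E0, Cmod_0 in Hb. lra. }
  apply (f_equal (Cmult (/ beta ^ i))) in E.
  rewrite Cmult_assoc, Cinv_l, Cmult_1_l in E by easy. easy. }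
intros E. destruct (Nat.lt_trichotomy n k) as [H | [H | H]]; [| easy |].
- now destruct (Hlt _ _ H).
- now destruct (Hlt _ _ H).
Qed.

(** * Complex differentiability *)

Definition cdiff (f : CC -> CC) (z l : CC) : Prop :=
  forall eps, 0 < eps -> exists d, 0 < d /\ forall w, Cmod (w - z) < d ->
    Cmod (f w - f z - l * (w - z)) <= eps * Cmod (w - z).

Lemma cdiff_is_derive (f : CC -> CC) (z l : CC) :
  cdiff f z l <-> is_derive (K := C_AbsRing) (V := C_NormedModule) f z l.
Proof.
split.
- intros H. split; [apply is_linear_scal_l |].
  intros x Hx.
  assert (E : z = x).
  { apply (is_filter_lim_locally_unique (K := C_AbsRing) (V := AbsRing_NormedModule C_AbsRing)).
    exact Hx. }
  subst x. intros eps. destruct (H eps (cond_pos eps)) as (d & Hd & Hw).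
  exists (mkposreal d Hd). intros w Hball.
  specialize (Hw w Hball). rewrite (Cmult_comm l) in Hw. exact Hw.
- intros [_ H] eps He.
  destruct (H z (fun P HP => HP) (mkposreal eps He)) as [d Hd].
  exists d. split; [apply cond_pos |]. intros w Hw.
  specialize (Hd w Hw).
  rewrite (Cmult_comm l). exact Hd.
Qed.

Lemma Hol_cdiff (f : CC -> CC) :
  Hol f <-> forall z, inD z -> exists l, cdiff f z l.
Proof.
split; intros H z Hz; destruct (H z Hz) as [l Hl]; exists l; now apply cdiff_is_derive.
Qed.

(** Estimates may lose a constant factor; the restriction [eps <= 1] serves the expansion of the
    exponential. *)
Lemma cdiff_of_multiple (f : CC -> CC) (z l : CC) (K : R) :
  (forall eps, 0 < eps <= 1 -> exists d, 0 < d /\ forall w, Cmod (w - z) < d ->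
    Cmod (f w - f z - l * (w - z)) <= K * eps * Cmod (w - z)) ->
  cdiff f z l.
Proof.
intros H eps He.
assert (HK : 0 < Rabs K + 1) by (pose proof (Rabs_pos K); lra).
destruct (H (Rmin 1 (eps / (Rabs K + 1)))) as (d & Hd & Hw).
- split; [apply Rmin_glb_lt; [lra | now apply Rdiv_lt_0_compat] | apply Rmin_l].
- exists d. split; [easy |]. intros w Hz. eapply Rle_trans; [now apply Hw |].
  apply Rmult_le_compat_r; [apply Cmod_ge_0 |].
  pose proof (Rmin_r 1 (eps / (Rabs K + 1))) as Hr.
  assert (Hp : 0 <= Rmin 1 (eps / (Rabs K + 1)))
    by (apply Rmin_glb; [lra | apply Rlt_le, Rdiv_lt_0_compat; lra]).
  apply Rle_div_r in Hr; [| easy]. pose proof (Rle_abs K). nra.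
Qed.

Lemma cdiff_ext_loc (f g : CC -> CC) (z l : CC) (r : R) :
  0 < r -> (forall w, Cmod (w - z) < r -> f w = g w) -> cdiff f z l -> cdiff g z l.
Proof.
intros Hr E H eps He. destruct (H eps He) as (d & Hd & Hw).
exists (Rmin d r). split; [now apply Rmin_glb_lt |]. intros w Hz.
assert (Hzd := Rlt_le_trans _ _ _ Hz (Rmin_l d r)).
assert (Hzr := Rlt_le_trans _ _ _ Hz (Rmin_r d r)).
rewrite <- !E; [now apply Hw | | easy].
replace (z - z)%C with (RtoC 0) by ring. now rewrite Cmod_0.
Qed.

Lemma cdiff_lipschitz (f : CC -> CC) (z l : CC) :
  cdiff f z l -> exists d, 0 < d /\ forall w, Cmod (w - z) < d ->
    Cmod (f w - f z) <= (Cmod l + 1) * Cmod (w - z).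
Proof.
intros H. destruct (H 1 Rlt_0_1) as (d & Hd & Hw). exists d. split; [easy |].
intros w Hz. specialize (Hw w Hz).
replace (f w - f z)%C with ((f w - f z - l * (w - z)) + l * (w - z))%C by ring.
eapply Rle_trans; [apply Cmod_triangle |]. rewrite Cmod_mult. lra.
Qed.

Lemma cdiff_continuous (f : CC -> CC) (z l : CC) (eps : R) :
  cdiff f z l -> 0 < eps -> exists d, 0 < d /\ forall w, Cmod (w - z) < d ->
    Cmod (f w - f z) < eps.
Proof.
intros H He. destruct (cdiff_lipschitz f z l H) as (d & Hd & Hw).
pose proof (Cmod_ge_0 l).
exists (Rmin d (eps / (Cmod l + 1))).
split; [apply Rmin_glb_lt; [easy | apply Rdiv_lt_0_compat; lra] |].
intros w Hz.
assert (Hzd := Rlt_le_trans _ _ _ Hz (Rmin_l _ _)).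
assert (Hzr := Rlt_le_trans _ _ _ Hz (Rmin_r _ _)).
eapply Rle_lt_trans; [now apply Hw |]. rewrite Rmult_comm. apply Rlt_div_r; lra.
Qed.

Lemma cdiff_const (c z : CC) : cdiff (fun _ => c) z 0.
Proof.
intros eps He. exists 1. split; [lra |]. intros w _.
replace (c - c - 0 * (w - z))%C with (RtoC 0) by ring. rewrite Cmod_0.
apply Rmult_le_pos; [lra | apply Cmod_ge_0].
Qed.

Lemma cdiff_id (z : CC) : cdiff (fun w => w) z 1.
Proof.
intros eps He. exists 1. split; [lra |]. intros w _.
replace (w - z - 1 * (w - z))%C with (RtoC 0) by ring. rewrite Cmod_0.
apply Rmult_le_pos; [lra | apply Cmod_ge_0].
Qed.

Lemma cdiff_plus (f g : CC -> CC) (z l l' : CC) :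
  cdiff f z l -> cdiff g z l' -> cdiff (fun w => f w + g w)%C z (l + l').
Proof.
intros Hf Hg. apply cdiff_of_multiple with 2. intros eps [He _].
destruct (Hf eps He) as (d & Hd & Hw). destruct (Hg eps He) as (d' & Hd' & Hw').
exists (Rmin d d'). split; [now apply Rmin_glb_lt |]. intros w Hz.
specialize (Hw w (Rlt_le_trans _ _ _ Hz (Rmin_l _ _))).
specialize (Hw' w (Rlt_le_trans _ _ _ Hz (Rmin_r _ _))).
replace (f w + g w - (f z + g z) - (l + l') * (w - z))%C
  with ((f w - f z - l * (w - z)) + (g w - g z - l' * (w - z)))%C by ring.
eapply Rle_trans; [apply Cmod_triangle |]. lra.
Qed.

Lemma cdiff_mult (f g : CC -> CC) (z l l' : CC) :
  cdiff f z l -> cdiff g z l' ->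
  cdiff (fun w => f w * g w)%C z (l * g z + f z * l').
Proof.
intros Hf Hg.
destruct (cdiff_lipschitz f z l Hf) as (d1 & Hd1 & Hf1).
destruct (cdiff_lipschitz g z l' Hg) as (d2 & Hd2 & Hg1).
apply cdiff_of_multiple
  with (Cmod (g z) + Cmod (f z) + (Cmod l + 1) * (Cmod l' + 1)).
intros eps [He _].
destruct (Hf eps He) as (d & Hd & Hw). destruct (Hg eps He) as (d' & Hd' & Hw').
(* Keeping [Cmod (w - z)] below [eps] turns the product of the two increments, which is quadratic,
   into a multiple of [eps * Cmod (w - z)]. *)
exists (Rmin eps (Rmin (Rmin d d') (Rmin d1 d2))).
split; [repeat apply Rmin_glb_lt; easy |]. intros w Hz.
apply Rmin_Rgt in Hz. destruct Hz as [Hz Hz'].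
apply Rmin_Rgt in Hz'. destruct Hz' as [Hz1 Hz2].
apply Rmin_Rgt in Hz1. apply Rmin_Rgt in Hz2.
specialize (Hw w (proj1 Hz1)). specialize (Hw' w (proj2 Hz1)).
specialize (Hf1 w (proj1 Hz2)). specialize (Hg1 w (proj2 Hz2)).
replace (f w * g w - f z * g z - (l * g z + f z * l') * (w - z))%C
  with ((f w - f z - l * (w - z)) * g z + f z * (g w - g z - l' * (w - z))
        + (f w - f z) * (g w - g z))%C by ring.
eapply Rle_trans; [apply Cmod_triangle |].
eapply Rle_trans; [apply Rplus_le_compat_r, Cmod_triangle |].
rewrite !Cmod_mult.
pose proof (Cmod_ge_0 (w - z)). pose proof (Cmod_ge_0 l). pose proof (Cmod_ge_0 l').
pose proof (Rmult_le_compat_r (Cmod (g z)) _ _ (Cmod_ge_0 _) Hw).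
pose proof (Rmult_le_compat_l (Cmod (f z)) _ _ (Cmod_ge_0 _) Hw').
assert (Cmod (f w - f z) * Cmod (g w - g z) <=
  (Cmod l + 1) * Cmod (w - z) * ((Cmod l' + 1) * Cmod (w - z)))
  by (apply Rmult_le_compat; (apply Cmod_ge_0 || easy)).
assert ((Cmod l + 1) * Cmod (w - z) * ((Cmod l' + 1) * Cmod (w - z))
  <= (Cmod l + 1) * (Cmod l' + 1) * eps * Cmod (w - z)).
{ replace ((Cmod l + 1) * Cmod (w - z) * ((Cmod l' + 1) * Cmod (w - z)))
    with ((Cmod l + 1) * (Cmod l' + 1) * Cmod (w - z) * Cmod (w - z)) by ring.
  apply Rmult_le_compat_r; [easy |].
  apply Rmult_le_compat_l; [nra | lra]. }
lra.
Qed.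

Lemma cdiff_comp (f g : CC -> CC) (z l l' : CC) :
  cdiff f (g z) l -> cdiff g z l' -> cdiff (fun w => f (g w)) z (l * l').
Proof.
intros Hf Hg.
destruct (cdiff_lipschitz g z l' Hg) as (d2 & Hd2 & Hg1).
apply cdiff_of_multiple with (Cmod l + (Cmod l' + 1)).
intros eps [He _].
destruct (Hf eps He) as (d & Hd & Hw). destruct (Hg eps He) as (d' & Hd' & Hw').
destruct (cdiff_continuous g z l' d Hg Hd) as (d3 & Hd3 & Hg3).
exists (Rmin d' (Rmin d2 d3)).
split; [repeat apply Rmin_glb_lt; easy |]. intros w Hz.
apply Rmin_Rgt in Hz. destruct Hz as [Hz1 Hz2]. apply Rmin_Rgt in Hz2.
specialize (Hw' w Hz1). specialize (Hg1 w (proj1 Hz2)).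
specialize (Hw (g w) (Hg3 w (proj2 Hz2))).
replace (f (g w) - f (g z) - l * l' * (w - z))%C
  with ((f (g w) - f (g z) - l * (g w - g z)) + l * (g w - g z - l' * (w - z)))%C by ring.
eapply Rle_trans; [apply Cmod_triangle |]. rewrite Cmod_mult.
pose proof (Rmult_le_compat_l (Cmod l) _ _ (Cmod_ge_0 _) Hw').
pose proof (Rmult_le_compat_l eps _ _ (Rlt_le _ _ He) Hg1).
lra.
Qed.

Lemma cdiff_scal (c : CC) (f : CC -> CC) (z l : CC) :
  cdiff f z l -> cdiff (fun w => c * f w)%C z (c * l).
Proof.
intros H. replace (c * l)%C with (0 * f z + c * l)%C by ring.
apply (cdiff_mult (fun _ => c)); [apply cdiff_const | easy].
Qed.

Lemma cdiff_pow (n : nat) (z : CC) : exists l, cdiff (fun w => w ^ n)%C z l.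
Proof.
induction n as [| n [l Hl]].
- exists (RtoC 0). exact (cdiff_const 1 z).
- exists (1 * z ^ n + z * l)%C.
  apply (cdiff_mult (fun w => w)); [apply cdiff_id | easy].
Qed.

(** Difference quotients along any points accumulating at [z] determine the derivative. The points
    used later are powers of [beta] tending to 1. *)
Lemma cdiff_unique_on (f : CC -> CC) (z l l' : CC) :
  cdiff f z l ->
  (forall eps, 0 < eps -> exists w, w <> z /\ Cmod (w - z) < eps /\
     (f w - f z)%C = (l' * (w - z))%C) ->
  l = l'.
Proof.
intros H Hw.
assert (E : Cmod (l' - l) <= 0).
{ apply le_epsilon. intros eps He. destruct (H eps He) as (d & Hd & Hf).
  destruct (Hw d Hd) as (w & Hne & Hwd & E). specialize (Hf w Hwd).
  rewrite E in Hf.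
  replace (l' * (w - z) - l * (w - z))%C with ((l' - l) * (w - z))%C in Hf by ring.
  rewrite Cmod_mult in Hf. rewrite Rplus_0_l.
  apply Rmult_le_reg_r with (Cmod (w - z)); [| easy].
  apply Cmod_gt_0. now apply Cminus_neq_0. }
assert (Z : (l' - l)%C = 0) by (apply Cmod_eq_0; pose proof (Cmod_ge_0 (l' - l)); lra).
replace l' with (l' - l + l)%C by ring. rewrite Z. ring.
Qed.

(** * The complex exponential *)

Lemma cexp_plus (x y : CC) : cexp (x + y) = (cexp x * cexp y)%C.
Proof.
unfold cexp. simpl. rewrite exp_plus, cos_plus, sin_plus.
apply injective_projections; simpl; ring.
Qed.

Lemma cexp_0 : cexp 0 = 1.
Proof. unfold cexp. simpl. rewrite exp_0, cos_0, sin_0. apply injective_projections; simpl; ring. Qed.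

Lemma Cmod_cexp (z : CC) : Cmod (cexp z) = exp (Re z).
Proof.
unfold cexp, Cmod. simpl.
pose proof (sin2_cos2 (snd z)) as E. unfold Rsqr in E.
replace (exp (fst z) * cos (snd z) * (exp (fst z) * cos (snd z) * 1)
  + exp (fst z) * sin (snd z) * (exp (fst z) * sin (snd z) * 1))
  with (exp (fst z) * exp (fst z) *
    (sin (snd z) * sin (snd z) + cos (snd z) * cos (snd z))) by ring.
rewrite E, Rmult_1_r. apply sqrt_square, Rlt_le, exp_pos.
Qed.

Lemma cexp_neq_0 (z : CC) : cexp z <> 0.
Proof. intros E. pose proof (exp_pos (Re z)). rewrite <- Cmod_cexp, E, Cmod_0 in H. lra. Qed.

Lemma cexp_opp (z : CC) : (cexp z * cexp (- z))%C = 1.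
Proof. rewrite <- cexp_plus, <- cexp_0. f_equal. ring. Qed.

Lemma derivable_pt_lim_0_bound (f : R -> R) (l eps : R) :
  derivable_pt_lim f 0 l -> 0 < eps -> exists d, 0 < d /\
    forall x, Rabs x < d -> Rabs (f x - f 0 - l * x) <= eps * Rabs x.
Proof.
intros H He. destruct (H eps He) as [d Hd]. exists d. split; [apply cond_pos |].
intros x Hx. destruct (Req_dec x 0) as [-> | Hx0].
- replace (f 0 - f 0 - l * 0) with 0 by ring. rewrite Rabs_R0. lra.
- specialize (Hd x Hx0 Hx). rewrite Rplus_0_l in Hd.
  replace (f x - f 0 - l * x) with (((f x - f 0) / x - l) * x) by (field; easy).
  rewrite Rabs_mult. apply Rmult_le_compat_r; [apply Rabs_pos | lra].
Qed.

Lemma cdiff_cexp_0 : cdiff cexp 0 1.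
Proof.
(* The real and imaginary parts of the error will be at most [3 eps r] and [4 eps r], so 10 leaves
   room. *)
apply cdiff_of_multiple with 10. intros eps [He He1].
destruct (derivable_pt_lim_0_bound exp 1 eps derivable_pt_lim_exp_0 He) as (d1 & Hd1 & H1).
destruct (derivable_pt_lim_0_bound cos (- sin 0) eps (derivable_pt_lim_cos 0) He) as (d2 & Hd2 & H2).
destruct (derivable_pt_lim_0_bound sin (cos 0) eps (derivable_pt_lim_sin 0) He) as (d3 & Hd3 & H3).
exists (Rmin eps (Rmin d1 (Rmin d2 d3))).
split; [repeat apply Rmin_glb_lt; easy |]. intros [x y] Hz.
replace ((x, y) - 0)%C with ((x, y) : CC) in * by (apply injective_projections; simpl; ring).
apply Rmin_Rgt in Hz. destruct Hz as [Hze Hz]. apply Rmin_Rgt in Hz.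
destruct Hz as [Hz1 Hz]. apply Rmin_Rgt in Hz. destruct Hz as [Hz2 Hz3].
pose proof (re_le_Cmod (x, y)) as Hx. pose proof (im_le_Cmod (x, y)) as Hy.
set (r := Cmod (x, y)) in *. simpl in Hx, Hy.
specialize (H1 x ltac:(lra)). specialize (H2 y ltac:(lra)). specialize (H3 y ltac:(lra)).
rewrite exp_0 in H1. rewrite sin_0, cos_0 in H2. rewrite cos_0, sin_0 in H3.
replace (cos y - 1 - - 0 * y) with (cos y - 1) in H2 by ring.
replace (sin y - 0 - 1 * y) with (sin y - y) in H3 by ring.
rewrite cexp_0.
eapply Rle_trans; [apply Cmod_le_re_im |]. unfold cexp, Re, Im. simpl.
replace (exp x * cos y + - (1) + - (1 * x - 0 * y))
  with ((exp x - 1 - 1 * x) * cos y + (1 + x) * (cos y - 1)) by ring.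
replace (exp x * sin y + - 0 + - (1 * y + 0 * x))
  with ((exp x - 1 - 1 * x) * sin y + x * sin y + (sin y - y)) by ring.
assert (Hr : 0 <= r) by apply Cmod_ge_0.
assert (Hc : Rabs (cos y) <= 1) by (apply Rabs_le; apply COS_bound).
assert (Hs : Rabs (sin y) <= 1) by (apply Rabs_le; apply SIN_bound).
assert (Hs2 : Rabs (sin y) <= 2 * r).
{ replace (sin y) with ((sin y - y) + y) by ring.
  eapply Rle_trans; [apply Rabs_triang |]. nra. }
assert (H1r : Rabs (exp x - 1 - 1 * x) <= eps * r) by nra.
assert (H2r : Rabs (cos y - 1) <= eps * r) by nra.
assert (H3r : Rabs (sin y - y) <= eps * r) by nra.
assert (Hx1 : Rabs (1 + x) <= 2).
{ eapply Rle_trans; [apply Rabs_triang |]. rewrite Rabs_R1. lra. }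
assert (0 <= eps * r) by nra.
assert (A1 : Rabs ((exp x - 1 - 1 * x) * cos y + (1 + x) * (cos y - 1)) <= 3 * eps * r).
{ eapply Rle_trans; [apply Rabs_triang |]. rewrite !Rabs_mult.
  pose proof (Rmult_le_compat _ _ _ _ (Rabs_pos _) (Rabs_pos _) H1r Hc).
  pose proof (Rmult_le_compat _ _ _ _ (Rabs_pos _) (Rabs_pos _) Hx1 H2r). lra. }
assert (A2 : Rabs ((exp x - 1 - 1 * x) * sin y + x * sin y + (sin y - y)) <= 4 * eps * r).
{ eapply Rle_trans; [apply Rabs_triang |].
  eapply Rle_trans; [apply Rplus_le_compat_r, Rabs_triang |]. rewrite !Rabs_mult.
  pose proof (Rmult_le_compat _ _ _ _ (Rabs_pos _) (Rabs_pos _) H1r Hs).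
  assert (Hxe : Rabs x <= eps) by lra.
  pose proof (Rmult_le_compat _ _ _ _ (Rabs_pos _) (Rabs_pos _) Hxe Hs2). lra. }
lra.
Qed.

(** The functional equation transports the derivative from 0 to [z]. *)
Lemma cdiff_cexp (z : CC) : cdiff cexp z (cexp z).
Proof.
replace (cexp z) with (cexp z * 1)%C at 1 by ring.
apply (cdiff_ext_loc (fun w => cexp z * cexp (w - z))%C _ _ _ 1); [lra | |].
- intros w _. rewrite <- cexp_plus. f_equal. ring.
- apply cdiff_scal. replace (RtoC 1) with (1 * (1 + 0))%C at 1 by ring.
  apply (cdiff_comp cexp (fun w => w - z)%C).
  + replace (z - z)%C with (RtoC 0) by ring. apply cdiff_cexp_0.
  + apply (cdiff_plus (fun w => w) (fun _ => - z)%C); [apply cdiff_id | apply cdiff_const].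
Qed.

(** * Holomorphic eigenfunctions of a rotation *)

(** The angle is [acos (x / r)] with the sign of [y]. Its compact range is what later gives extrema
    and uniform continuity on circles. *)
Lemma polar_form (z : CC) :
  exists t, - PI <= t <= PI /\ z = (Cmod z * cos t, Cmod z * sin t).
Proof.
destruct (Req_dec (Cmod z) 0) as [E | E].
- exists 0. pose proof PI_RGT_0. split; [lra |].
  rewrite E, (Cmod_eq_0 z E). apply injective_projections; simpl; ring.
- destruct z as [x y]. set (r := Cmod (x, y)) in *.
  assert (Hr : 0 < r) by (pose proof (Cmod_ge_0 (x, y)); unfold r in *; lra).
  assert (E2 : r * r = x * x + y * y).
  { pose proof (Cmod2_alt (x, y)) as H. fold r in H. simpl in H. lra. }
  assert (Hx : -1 <= x / r <= 1).
  { split; [apply Rle_div_r | apply Rle_div_l]; nra. }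
  assert (Hs : sin (acos (x / r)) = Rabs y / r).
  { rewrite sin_acos by easy.
    replace (1 - Rsqr (x / r)) with (Rsqr (Rabs y / r)).
    - apply sqrt_Rsqr. apply Rmult_le_pos; [apply Rabs_pos |].
      apply Rlt_le, Rinv_0_lt_compat, Hr.
    - unfold Rsqr. apply Rmult_eq_reg_r with (r * r); [| nra].
      field_simplify; [| lra | lra].  pose proof (pow2_abs y). simpl in *. nra. }
  pose proof (acos_bound (x / r)) as Hb.
  destruct (Rle_dec 0 y) as [Hy | Hy].
  + exists (acos (x / r)). split; [lra |].
    rewrite Hs, cos_acos, Rabs_pos_eq by easy. f_equal; field; lra.
  + exists (- acos (x / r)). split; [lra |].
    rewrite sin_neg, cos_neg, Hs, cos_acos, Rabs_left by (easy || lra).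
    f_equal; field; lra.
Qed.

Lemma cexp_surjective (z : CC) : z <> 0 -> exists s, cexp s = z.
Proof.
intros Hz. destruct (polar_form z) as (t & _ & E).
exists (ln (Cmod z), t). unfold cexp. simpl.
rewrite exp_ln by now apply Cmod_gt_0. now symmetry.
Qed.

Lemma cexp_nat_mult (n : nat) (s : CC) : cexp (INR n * s) = (cexp s ^ n)%C.
Proof.
induction n as [| n IH].
- simpl. rewrite <- cexp_0. f_equal. ring.
- rewrite S_INR, RtoC_plus. simpl Cpow. rewrite <- IH, <- cexp_plus. f_equal. ring.
Qed.

(** The segment from [p] to [q] stays in the half plane by convexity, and along it the real and
    imaginary parts of [F] have derivative zero. *)
Lemma zero_derivative_half_plane (F : CC -> CC) (A : R) :
  (forall s, Re s < A -> cdiff F s 0) ->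
  forall p q, Re p < A -> Re q < A -> F p = F q.
Proof.
intros HF p q Hp Hq.
set (g := fun t : R => (p + t * (q - p))%C).
assert (Hg : forall t, 0 <= t <= 1 -> Re (g t) < A).
{ intros t Ht. replace (Re (g t)) with ((1 - t) * Re p + t * Re q)
    by (unfold g, Re; simpl; ring).
  destruct (Rle_lt_or_eq_dec t 1 (proj2 Ht)) as [H1 | ->]; [| lra].
  pose proof (Rmult_lt_compat_l (1 - t) _ _ ltac:(lra) Hp).
  pose proof (Rmult_le_compat_l t _ _ (proj1 Ht) (Rlt_le _ _ Hq)). lra. }
(* [P] stands for [Re] and for [Im], treated at once. *)
assert (HD : forall (P : CC -> R), (forall x y, P (x - y)%C = P x - P y) ->
  (forall x, Rabs (P x) <= Cmod x) -> P (F p) = P (F q)).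
{ intros P HPm HPb.
  assert (E0 : g 0 = p) by (unfold g; ring).
  assert (E1 : g 1 = q) by (unfold g; ring).
  rewrite <- E0, <- E1.
  apply (eq_is_derive (fun t => P (F (g t)))); [| lra].
  intros t Ht. apply is_derive_Reals. intros eps He.
  pose proof (Cmod_ge_0 (q - p)) as Hc.
  destruct (HF (g t) (Hg t Ht) (eps / (2 * (Cmod (q - p) + 1)))) as (d & Hd & Hw).
  { apply Rdiv_lt_0_compat; lra. }
  assert (Hd' : 0 < d / (Cmod (q - p) + 1)) by (apply Rdiv_lt_0_compat; lra).
  exists (mkposreal _ Hd'). intros k Hk0 Hk. simpl in Hk.
  assert (Ek : (g (t + k)%R - g t)%C = (k * (q - p))%C).
  { unfold g. rewrite RtoC_plus. ring. }
  specialize (Hw (g (t + k)%R)). rewrite Ek, Cmod_mult, Cmod_R in Hw.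
  apply Rlt_div_r in Hk; [| lra].
  pose proof (Rabs_pos k).
  specialize (Hw ltac:(nra)).
  replace (F (g (t + k)%R) - F (g t) - 0 * (k * (q - p)))%C
    with (F (g (t + k)%R) - F (g t))%C in Hw by ring.
  assert (Hk1 : 0 < Rabs k) by now apply Rabs_pos_lt.
  replace (zero : R) with 0 by reflexivity.
  rewrite Rminus_0_r. unfold Rdiv. rewrite Rabs_mult, Rabs_inv.
  apply Rlt_div_l; [easy |]. rewrite <- HPm.
  eapply Rle_lt_trans; [apply HPb |]. eapply Rle_lt_trans; [apply Hw |].
  replace (eps / (2 * (Cmod (q - p) + 1)) * (Rabs k * Cmod (q - p)))
    with (eps * Rabs k * (Cmod (q - p) / (2 * (Cmod (q - p) + 1)))) by (field; lra).
  rewrite <- (Rmult_1_r (eps * Rabs k)) at 2.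
  apply Rmult_lt_compat_l; [nra |]. apply Rlt_div_l; lra. }
apply injective_projections.
- apply (HD Re); [easy | apply re_le_Cmod].
- apply (HD Im); [easy | apply im_le_Cmod].
Qed.

(** With k = x + iy, the modulus [exp (- 2 PI y)] forces y = 0, and then [cos (2 PI x) = 1] means
    [sin (PI x) = 0]. *)
Lemma cexp_period_integer (k : CC) : cexp (k * (0, (2 * PI)%R)) = 1 -> exists N : Z, k = IZR N.
Proof.
intros E. destruct k as [x y].
pose proof PI_RGT_0 as Hpi.
assert (E1 : Cmod (cexp ((x, y) * (0, (2 * PI)%R))) = 1) by (rewrite E; apply Cmod_1).
rewrite Cmod_cexp in E1. unfold Re in E1. simpl in E1.
rewrite <- exp_0 in E1. apply exp_inv in E1.
assert (Hy : y = 0) by nra. subst y.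
apply (f_equal fst) in E. unfold cexp in E. simpl in E.
replace (x * 0 - 0 * (2 * PI)) with 0 in E by ring.
replace (x * (2 * PI) + 0 * 0) with (2 * (x * PI)) in E by ring.
rewrite exp_0, cos_2a_sin in E.
assert (Hs : sin (x * PI) = 0) by nra.
destruct (sin_eq_0_0 _ Hs) as [N HN]. exists N.
apply Rmult_eq_reg_r in HN; [| lra]. now rewrite HN.
Qed.

Lemma cdiff_dilation (h : CC -> CC) (z l : CC) :
  cdiff h z l -> cdiff (fun w => h (w * z)%C) 1 (l * z).
Proof.
intros H. apply (cdiff_comp h (fun w => w * z)%C); [now rewrite Cmult_1_l |].
pose proof (cdiff_mult (fun w => w) (fun _ => z) 1 1 0 (cdiff_id 1) (cdiff_const z 1)) as E.
cbv beta in E. now replace (1 * z + 1 * 0)%C with z in E by ring.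
Qed.

(* A point where [h] is nonzero fixes an Euler equation [z h' = kappa h]: the function
   [w |-> h (w z) h z0 - h (w z0) h z] vanishes at the powers of [beta], which accumulate
   at 1, so its derivative at 1 is zero. *)
Lemma rotation_eigen_euler (beta mu : CC) (r : R) (h : CC -> CC) (z0 : CC) :
  irrational_rotation beta ->
  (forall z, Cmod z < r -> exists l, cdiff h z l) ->
  (forall z, Cmod z < r -> h (beta * z)%C = (mu * h z)%C) ->
  Cmod z0 < r -> h z0 <> 0 ->
  exists kappa, forall z l, Cmod z < r -> cdiff h z l -> (z * l)%C = (kappa * h z)%C.
Proof.
intros Hb Hd Heq Hz0 Hh0.
(* The Euler equation at [z0] itself leaves only this value for [kappa]. *)
destruct (Hd z0 Hz0) as [l0 Hl0]. exists (z0 * l0 / h z0)%C. intros z l Hz Hl.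
assert (Hpow : forall n z, Cmod z < r -> h (beta ^ n * z)%C = (mu ^ n * h z)%C).
{ intros n x Hx. induction n as [| n IH]; simpl; [now rewrite !Cmult_1_l |].
  rewrite <- !Cmult_assoc, Heq, IH; [easy |].
  rewrite Cmod_mult, Cmod_pow_unit by apply Hb. lra. }
assert (E : (l * z * h z0 + - h z * (l0 * z0))%C = 0).
{ apply (cdiff_unique_on (fun w => h (w * z) * h z0 + - h z * h (w * z0))%C 1).
  - apply cdiff_plus.
    + replace (l * z * h z0)%C with (l * z * h z0 + h (1 * z)%C * 0)%C by ring.
      apply (cdiff_mult (fun w => h (w * z)%C) (fun _ => h z0)); [| apply cdiff_const].
      now apply cdiff_dilation.
    + apply (cdiff_scal (- h z) (fun w => h (w * z0)%C)). now apply cdiff_dilation.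
  - intros eps He. destruct (orbit_returns beta eps Hb He) as (n & Hn & Hne).
    exists (beta ^ n)%C. split; [now apply Hb | split; [easy |]].
    rewrite !Hpow, !Cmult_1_l by easy. ring. }
apply (f_equal (fun x => x / h z0 + z0 * l0 / h z0 * h z)%C) in E.
transitivity ((l * z * h z0 + - h z * (l0 * z0)) / h z0 + z0 * l0 / h z0 * h z)%C;
  [field; easy |].
rewrite E. field. easy.
Qed.

Lemma rotation_eigen_monomial (beta mu : CC) (r : R) (h : CC -> CC) (z1 : CC) :
  irrational_rotation beta ->
  (forall z, Cmod z < r -> exists l, cdiff h z l) ->
  (forall z, Cmod z < r -> h (beta * z)%C = (mu * h z)%C) ->
  Cmod z1 < r -> h z1 <> 0 ->
  exists (n : nat) (c : CC), c <> 0 /\ forall z, Cmod z < r -> h z = (c * z ^ n)%C.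
Proof.
intros Hb Hd Heq Hz1 Hh1.
assert (Hr : 0 < r) by (pose proof (Cmod_ge_0 z1); lra).
destruct (rotation_eigen_euler beta mu r h z1 Hb Hd Heq Hz1 Hh1) as [kappa Hk].
assert (Hlt : forall s, Re s < ln r -> Cmod (cexp s) < r).
{ intros s Hs. rewrite Cmod_cexp, <- (exp_ln r Hr). now apply exp_increasing. }
assert (Hlog : forall z, Cmod z < r -> z <> 0 -> exists s, cexp s = z /\ Re s < ln r).
{ intros z Hz Hz0. destruct (cexp_surjective z Hz0) as [s E]. exists s. split; [easy |].
  apply exp_lt_inv. rewrite exp_ln, <- Cmod_cexp, E; easy. }
set (s0 := RtoC (ln r - 1)).
assert (Hs0 : Re s0 < ln r) by (unfold s0, Re; simpl; lra).
(* The exponential maps the half plane [Re s < ln r] onto the punctured disc; in this coordinate the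
   Euler equation says that [F] has derivative zero. *)
set (F := fun s => (h (cexp s) * cexp (- kappa * s))%C).
assert (HF : forall s, Re s < ln r -> F s = F s0).
{ intros s Hs. apply (zero_derivative_half_plane F (ln r)); [| easy | easy].
  clear s Hs. intros s Hs.
  destruct (Hd (cexp s) (Hlt s Hs)) as [l Hl].
  pose proof (Hk (cexp s) l (Hlt s Hs) Hl) as Ek.
  replace (RtoC 0) with
    ((l * cexp s) * cexp (- kappa * s) + h (cexp s) * (cexp (- kappa * s) * (- kappa * 1)))%C.
  - apply (cdiff_mult (fun s => h (cexp s)) (fun s => cexp (- kappa * s))).
    + apply cdiff_comp; [easy | apply cdiff_cexp].
    + apply (cdiff_comp cexp (fun s => - kappa * s)%C); [apply cdiff_cexp |].
      apply (cdiff_scal (- kappa) (fun s => s)), cdiff_id.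
  - rewrite (Cmult_comm l), Ek. ring. }
set (c := F s0) in *.
assert (Hh : forall s, Re s < ln r -> h (cexp s) = (c * cexp (kappa * s))%C).
{ intros s Hs. rewrite <- (HF s Hs). unfold F.
  rewrite <- Cmult_assoc, (Cmult_comm (cexp (- kappa * s))).
  replace (- kappa * s)%C with (- (kappa * s))%C by ring.
  rewrite cexp_opp. ring. }
(* If [c] were 0, then [h] would vanish on the punctured disc and, by continuity, at 0, against
   [h z1 <> 0]. *)
assert (Hc : c <> 0).
{ intros Ec.
  assert (Hz : forall s, Re s < ln r -> h (cexp s) = 0).
  { intros s Hs. rewrite (Hh s Hs), Ec. ring. }
  destruct (Ceq_dec z1 0) as [E1 | E1].
  - subst z1. destruct (Hd 0 Hz1) as [l Hl].
    destruct (cdiff_continuous h 0 l (Cmod (h 0)) Hl) as (d & Hd0 & Hw);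
      [now apply Cmod_gt_0 |].
    set (x := RtoC (Rmin (d / 2) (r / 2))).
    assert (Hx : 0 < Rmin (d / 2) (r / 2)) by (apply Rmin_glb_lt; lra).
    assert (Ex : Cmod x = Rmin (d / 2) (r / 2)) by (unfold x; rewrite Cmod_R, Rabs_pos_eq; lra).
    destruct (Hlog x) as (s & Es & Hs).
    + rewrite Ex. pose proof (Rmin_r (d / 2) (r / 2)). lra.
    + apply Cmod_gt_0. lra.
    + specialize (Hw x). rewrite <- Es, (Hz s Hs), Es in Hw.
      replace (0 - h 0)%C with (- h 0)%C in Hw by ring. rewrite Cmod_opp in Hw.
      replace (x - 0)%C with x in Hw by ring. rewrite Ex in Hw.
      pose proof (Rmin_l (d / 2) (r / 2)). lra.
  - destruct (Hlog z1 Hz1 E1) as (s & Es & Hs). apply Hh1. rewrite <- Es. auto. }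
(* Adding the period 2 pi i to [s0] leaves [cexp s0] fixed but multiplies [cexp (kappa * s0)] by
   [cexp (2 pi i kappa)], which must therefore be 1. *)
destruct (cexp_period_integer kappa) as [N HN].
{ pose proof (Hh (s0 + (0, (2 * PI)%R))%C) as E.
  assert (Es : cexp (s0 + (0, (2 * PI)%R)) = cexp s0).
  { rewrite cexp_plus. replace (cexp (0, (2 * PI)%R)) with (RtoC 1); [ring |].
    unfold cexp. simpl. rewrite exp_0, cos_2PI, sin_2PI.
    apply injective_projections; simpl; ring. }
  rewrite Es, (Hh s0 Hs0), Cmult_plus_distr_l, cexp_plus in E.
  specialize (E ltac:(unfold Re in *; simpl in *; lra)).
  apply (f_equal (fun x => x / (c * cexp (kappa * s0)))%C) in E.
  transitivity (c * (cexp (kappa * s0) * cexp (kappa * (0, (2 * PI)%R))) / (c * cexp (kappa * s0)))%C.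
  - field. split; [apply cexp_neq_0 | easy].
  - rewrite <- E. field. split; [apply cexp_neq_0 | easy]. }
assert (HN0 : (0 <= N)%Z).
{ destruct (Z.le_gt_cases 0 N) as [H | H]; [easy | exfalso].
  assert (HNr : IZR N <= -1) by (apply IZR_le; lia).
  destruct (Hd 0) as [l Hl]; [rewrite Cmod_0; lra |].
  destruct (cdiff_continuous h 0 l 1 Hl Rlt_0_1) as (d & Hd0 & Hw).
  (* For negative [N] the modulus |c| e^(N x) of [h] at e^x is unbounded as x tends to minus
     infinity. Here [x <= - T] and [N <= -1] give e^(N x) >= 1 + T, so that modulus exceeds |h 0| +
     1 although e^x lies within [d] of 0. *)
  set (T := (Cmod (h 0) + 1) / Cmod c).
  assert (Hcm : 0 < Cmod c) by now apply Cmod_gt_0.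
  assert (HT : 0 < T) by (apply Rdiv_lt_0_compat; [pose proof (Cmod_ge_0 (h 0)); lra | easy]).
  set (x := Rmin (ln d - 1) (Rmin (ln r - 1) (- T))).
  assert (Hx1 : x <= ln d - 1) by apply Rmin_l.
  assert (Hx2 : x <= ln r - 1) by (eapply Rle_trans; [apply Rmin_r | apply Rmin_l]).
  assert (Hx3 : x <= - T) by (eapply Rle_trans; [apply Rmin_r | apply Rmin_r]).
  assert (Eh := Hh (RtoC x)). rewrite HN in Eh.
  specialize (Eh ltac:(unfold Re; simpl; lra)).
  specialize (Hw (cexp x)).
  replace (cexp x - 0)%C with (cexp x) in Hw by ring.
  rewrite Cmod_cexp in Hw. unfold Re in Hw at 1. simpl in Hw.
  assert (Hxd : exp x < d) by (rewrite <- (exp_ln d Hd0); apply exp_increasing; lra).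
  specialize (Hw Hxd).
  pose proof (Cmod_triangle_inv (h (cexp x)) (h 0)) as Ht.
  rewrite Eh in Hw, Ht at 1. rewrite Eh in Ht.
  rewrite Cmod_mult, Cmod_cexp in Ht.
  replace (Re (IZR N * x)) with (IZR N * x) in Ht by (unfold Re; simpl; ring).
  assert (He : 1 + T <= exp (IZR N * x)).
  { eapply Rle_trans; [| apply exp_ineq1_le]. nra. }
  assert (Cmod c * (1 + T) <= Cmod c * exp (IZR N * x))
    by (apply Rmult_le_compat_l; lra).
  assert (ET : Cmod c * T = Cmod (h 0) + 1) by (unfold T; field; lra).
  lra. }
destruct (Z_of_nat_complete N HN0) as [n En].
assert (Ek : kappa = INR n) by (rewrite HN, En, <- INR_IZR_INZ; easy).
exists n, c. split; [easy |].
assert (Hnz : forall z, Cmod z < r -> z <> 0 -> h z = (c * z ^ n)%C).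
{ intros z Hz Hz0. destruct (Hlog z Hz Hz0) as (s & <- & Hs).
  now rewrite (Hh s Hs), Ek, cexp_nat_mult. }
(* The value at 0, not reached by the exponential, follows from continuity of the difference
   [h z - c z^n]. *)
intros z Hz. destruct (Ceq_dec z 0) as [-> | Hz0]; [| now apply Hnz].
apply NNPP. intros Hne.
destruct (Hd 0 Hz) as [l Hl]. destruct (cdiff_pow n 0) as [l' Hl'].
pose proof (cdiff_plus _ _ 0 _ _ Hl (cdiff_scal (- c) _ 0 l' Hl')) as HG.
destruct (cdiff_continuous _ 0 _ (Cmod (h 0 - c * 0 ^ n)) HG) as (d & Hd0 & Hw);
  [apply Cmod_gt_0, Cminus_neq_0, Hne |].
set (x := Rmin (d / 2) (r / 2)) in *.
assert (Hx : 0 < x) by (apply Rmin_glb_lt; lra).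
assert (Hxd : x <= d / 2) by apply Rmin_l.
assert (Hxr : x <= r / 2) by apply Rmin_r.
specialize (Hw x). replace (x - 0)%C with (RtoC x) in Hw by ring.
assert (Ex : Cmod x = x) by (rewrite Cmod_R, Rabs_pos_eq; lra).
rewrite Ex, Hnz in Hw; [| lra | apply Cmod_gt_0; lra].
specialize (Hw ltac:(lra)).
replace (c * x ^ n + - c * x ^ n - (h 0 + - c * 0 ^ n))%C
  with (- (h 0 - c * 0 ^ n))%C in Hw by ring.
rewrite Cmod_opp in Hw. lra.
Qed.

(** * Power series *)

(** By Bernoulli [k x <= (1 + x)^k], so k^2 s^k is at most ((1 + x)^2 s)^k / x^2. The choice x = (1
    - s)/4 keeps (1 + x)^2 s below 1. *)
Lemma square_geom_bound (s : R) :
  0 < s < 1 -> exists K q, 0 <= q < 1 /\ 0 <= K /\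
    forall k : nat, INR k * INR k * s ^ k <= K * q ^ k.
Proof.
intros Hs. set (x := (1 - s) / 4). assert (Hx : 0 < x < 1 / 4) by (unfold x; lra).
assert (Es : s = 1 - 4 * x) by (unfold x; field).
exists (/ (x * x)), ((1 + x) * (1 + x) * s).
assert (Hxx : 0 < x * x) by nra. repeat split.
- nra.
- rewrite Es. nra.
- apply Rlt_le, Rinv_0_lt_compat, Hxx.
- intros k. pose proof (poly k x (proj1 Hx)) as Hp. pose proof (pos_INR k) as Hk.
  rewrite !Rpow_mult_distr.
  apply Rmult_le_reg_l with (x * x); [easy |].
  replace (x * x * (/ (x * x) * ((1 + x) ^ k * (1 + x) ^ k * s ^ k)))
    with ((1 + x) ^ k * (1 + x) ^ k * s ^ k) by (field; lra).
  replace (x * x * (INR k * INR k * s ^ k))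
    with ((INR k * x) * (INR k * x) * s ^ k) by ring.
  apply Rmult_le_compat_r; [apply pow_le; lra |].
  apply Rmult_le_compat; nra.
Qed.

(* The derivative [k z^(k-1)], without the predecessor. *)
Fixpoint dpow (z : CC) (k : nat) : CC :=
  match k with O => 0 | S p => (z * dpow z p + z ^ p)%C end.

Lemma dpow_bound (z : CC) (rho : R) (k : nat) :
  0 <= rho -> Cmod z <= rho -> Cmod (dpow z k) * rho <= INR k * rho ^ k.
Proof.
intros Hr Hz. induction k as [| k IH].
- simpl. rewrite Cmod_0. lra.
- rewrite S_INR. simpl dpow. simpl pow.
  apply Rle_trans with (rho * (Cmod (dpow z k) * rho) + rho ^ k * rho).
  + rewrite <- Rmult_assoc, <- Rmult_plus_distr_r. apply Rmult_le_compat_r; [easy |].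
    eapply Rle_trans; [apply Cmod_triangle |]. rewrite Cmod_mult, Cmod_pow.
    apply Rplus_le_compat.
    * apply Rmult_le_compat_r; [apply Cmod_ge_0 | easy].
    * apply pow_incr. split; [apply Cmod_ge_0 | easy].
  + pose proof (Rmult_le_compat_l rho _ _ Hr IH). lra.
Qed.

(** The remainder E_k satisfies E_(k+1) = w E_k + (w - z)^2 [dpow z k], so it grows like k^2
    rho^(k-2). The factor rho^2 on the left replaces the exponent k - 2. *)
Lemma pow_taylor_bound (z w : CC) (rho : R) (k : nat) :
  0 <= rho -> Cmod z <= rho -> Cmod w <= rho ->
  Cmod (w ^ k - z ^ k - dpow z k * (w - z)) * (rho * rho)
    <= Cmod (w - z) * Cmod (w - z) * (INR k * INR k * rho ^ k).
Proof.
intros Hr Hz Hw. induction k as [| k IH].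
- simpl. replace (1 - 1 - 0 * (w - z))%C with (RtoC 0) by ring. rewrite Cmod_0. lra.
- replace (w ^ S k - z ^ S k - dpow z (S k) * (w - z))%C
    with (w * (w ^ k - z ^ k - dpow z k * (w - z)) + (w - z) * (w - z) * dpow z k)%C
    by (simpl; ring).
  pose proof (Cmod_triangle (w * (w ^ k - z ^ k - dpow z k * (w - z)))
    ((w - z) * (w - z) * dpow z k)) as Ht.
  rewrite !Cmod_mult in Ht.
  set (E := Cmod (w ^ k - z ^ k - dpow z k * (w - z))) in *.
  set (h := Cmod (w - z)) in *.
  pose proof (dpow_bound z rho k Hr Hz) as Hd.
  assert (HE : 0 <= E) by apply Cmod_ge_0. assert (Hh : 0 <= h) by apply Cmod_ge_0.
  pose proof (pos_INR k) as Hk. pose proof (pow_le rho k Hr) as Hp.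
  rewrite S_INR. simpl pow.
  apply Rle_trans with (rho * (E * (rho * rho)) + h * h * rho * (Cmod (dpow z k) * rho)).
  + apply Rle_trans with ((Cmod w * E + h * h * Cmod (dpow z k)) * (rho * rho)).
    * apply Rmult_le_compat_r; [nra | easy].
    * assert (Cmod w * E * (rho * rho) <= rho * E * (rho * rho)).
      { apply Rmult_le_compat_r; [nra |]. apply Rmult_le_compat_r; easy. }
      lra.
  + pose proof (Rmult_le_compat_l rho _ _ Hr IH) as H1.
    assert (H2 : h * h * rho * (Cmod (dpow z k) * rho) <= h * h * rho * (INR k * rho ^ k)).
    { apply Rmult_le_compat_l; [apply Rmult_le_pos; nra | easy]. }
    assert (H3 : 0 <= h * h * rho * rho ^ k * (INR k + 1))
      by (repeat apply Rmult_le_pos; lra).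
    apply Rle_trans with (rho * (h * h * (INR k * INR k * rho ^ k))
      + h * h * rho * (INR k * rho ^ k)); [lra |].
    replace (h * h * ((INR k + 1) * (INR k + 1) * (rho * rho ^ k)))
      with (rho * (h * h * (INR k * INR k * rho ^ k)) + h * h * rho * (INR k * rho ^ k)
        + h * h * rho * rho ^ k * (INR k + 1)) by ring.
    lra.
Qed.

(* The radius of convergence of [sum c_k z^k] is at least [rad]. *)
Definition coef_bounded (c : nat -> CC) (rad : R) : Prop :=
  forall r, 0 < r < rad -> exists M, forall k, Cmod (c k) * r ^ k <= M.

Lemma coef_term_bound (c : nat -> CC) (z : CC) (r M : R) (k : nat) :
  0 < r -> Cmod (c k) * r ^ k <= M -> Cmod (c k * z ^ k) <= M * (Cmod z / r) ^ k.
Proof.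
intros Hr H. rewrite Cmod_mult, Cmod_pow.
replace (Cmod z) with (r * (Cmod z / r)) at 1 by (field; lra).
rewrite Rpow_mult_distr, <- Rmult_assoc. apply Rmult_le_compat_r; [| easy].
apply pow_le, Rmult_le_pos; [apply Cmod_ge_0 | apply Rlt_le, Rinv_0_lt_compat, Hr].
Qed.

Lemma coef_bounded_geom (c : nat -> CC) (rad : R) (z : CC) :
  coef_bounded c rad -> Cmod z < rad ->
  exists M s, 0 <= s < 1 /\ forall k, Cmod (c k * z ^ k) <= M * s ^ k.
Proof.
intros Hc Hz. pose proof (Cmod_ge_0 z).
destruct (Hc ((Cmod z + rad) / 2)) as [M HM]; [lra |].
exists M, (Cmod z / ((Cmod z + rad) / 2)). split.
- split; [apply Rle_div_r; lra | apply Rlt_div_l; lra].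
- intros k. apply coef_term_bound; [lra | apply HM].
Qed.

(** Termwise differentiation: the second-order remainders of the monomials sum to a multiple of |w -
    z|^2. *)
Lemma pseries_cdiff (c : nat -> CC) (g : CC -> CC) (rad : R) :
  coef_bounded c rad ->
  (forall z, Cmod z < rad -> cser (fun k => c k * z ^ k)%C (g z)) ->
  forall z, Cmod z < rad -> exists l, cdiff g z l.
Proof.
intros Hc Hg z Hz. pose proof (Cmod_ge_0 z) as Hz0.
(* [rho] bounds the points [w] near [z], and [r] is where the coefficients are estimated; the gap
   between them absorbs the factor k^2. *)
set (rho := (2 * Cmod z + rad) / 3). set (r := (Cmod z + 2 * rad) / 3).
assert (Hrho : 0 < rho) by (unfold rho; lra).
assert (Hzrho : Cmod z < rho) by (unfold rho; lra).
assert (Hr : rho < r < rad) by (unfold rho, r; lra). clearbody rho r.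
destruct (Hc r) as [M HM]; [lra |].
destruct (square_geom_bound (rho / r)) as (K & q & Hq & HK & Hsq).
{ split; [apply Rdiv_lt_0_compat; lra | apply Rlt_div_l; lra]. }
assert (HM0 : 0 <= M).
{ specialize (HM O). simpl in HM. pose proof (Cmod_ge_0 (c O)). lra. }
assert (Hcb : forall k, Cmod (c k) * (INR k * INR k * rho ^ k) <= M * K * q ^ k).
{ intros k.
  replace (rho ^ k) with (r ^ k * (rho / r) ^ k)
    by (rewrite <- Rpow_mult_distr; f_equal; field; lra).
  replace (Cmod (c k) * (INR k * INR k * (r ^ k * (rho / r) ^ k)))
    with ((Cmod (c k) * r ^ k) * (INR k * INR k * (rho / r) ^ k)) by ring.
  rewrite (Rmult_assoc M). apply Rmult_le_compat; [| | apply HM | apply Hsq].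
  - apply Rmult_le_pos; [apply Cmod_ge_0 | apply pow_le; lra].
  - apply Rmult_le_pos; [pose proof (pos_INR k); nra |].
    apply pow_le, Rlt_le, Rdiv_lt_0_compat; lra. }
destruct (cser_exists (fun k => c k * dpow z k)%C (M * K / rho) q Hq) as [l Hl].
{ intros k. rewrite Cmod_mult.
  replace (M * K / rho * q ^ k) with (M * K * q ^ k / rho) by (field; lra).
  apply (Rle_div_r _ _ rho); [easy |]. eapply Rle_trans; [| apply Hcb].
  rewrite Rmult_assoc. apply Rmult_le_compat_l; [apply Cmod_ge_0 |].
  eapply Rle_trans; [apply dpow_bound; lra |].
  apply Rmult_le_compat_r; [apply pow_le; lra |].
  destruct k; [simpl; lra |]. pose proof (pos_INR k). rewrite S_INR. nra. }
exists l. set (C := M * K / (rho * rho) / (1 - q)).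
assert (HC : 0 <= C).
{ unfold C. apply Rle_div_r; [lra |]. rewrite Rmult_0_l. apply Rle_div_r; nra. }
apply cdiff_of_multiple with C. intros eps [He _].
exists (Rmin eps (rho - Cmod z)). split; [apply Rmin_glb_lt; lra |].
intros w Hw. apply Rmin_Rgt in Hw. destruct Hw as [Hw1 Hw2].
assert (Hwr : Cmod w <= rho) by (pose proof (Cmod_triangle_inv w z); lra).
assert (Hs : cser (fun k => c k * (w ^ k - z ^ k - dpow z k * (w - z)))%C
  (g w + - (1) * g z + - (w - z) * l)).
{ apply cser_ext with (fun k => c k * w ^ k + - (1) * (c k * z ^ k)
    + - (w - z) * (c k * dpow z k))%C; [intros k; ring |].
  apply (cser_plus (fun k => c k * w ^ k + - (1) * (c k * z ^ k))%C
    (fun k => - (w - z) * (c k * dpow z k))%C).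
  - apply cser_plus; [apply Hg; lra | now apply cser_scal, Hg].
  - now apply cser_scal. }
set (h := Cmod (w - z)) in *. assert (Hh : 0 <= h) by apply Cmod_ge_0.
replace (g w - g z - l * (w - z))%C with (g w + - (1) * g z + - (w - z) * l - csum
  (fun k => c k * (w ^ k - z ^ k - dpow z k * (w - z))) 0)%C by (simpl; ring).
eapply Rle_trans.
- apply (cser_tail _ _ (h * h * (M * K) / (rho * rho)) q O Hq); [| exact Hs].
  intros k. rewrite Cmod_mult.
  replace (h * h * (M * K) / (rho * rho) * q ^ k)
    with (h * h * (M * K * q ^ k) / (rho * rho)) by (field; lra).
  apply (Rle_div_r _ _ (rho * rho)); [nra |]. rewrite Rmult_assoc.
  eapply Rle_trans; [apply Rmult_le_compat_l; [apply Cmod_ge_0 |]|].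
  + apply pow_taylor_bound; lra.
  + fold h.
    replace (Cmod (c k) * (h * h * (INR k * INR k * rho ^ k)))
      with (h * h * (Cmod (c k) * (INR k * INR k * rho ^ k))) by ring.
    apply Rmult_le_compat_l; [nra | apply Hcb].
- replace (h * h * (M * K) / (rho * rho) * q ^ 0 / (1 - q)) with (C * h * h)
    by (unfold C; simpl; field; lra).
  apply Rmult_le_compat_r; [easy |]. apply Rmult_le_compat_l; lra.
Qed.

Lemma pseries_sum_exists (c : nat -> CC) (rad : R) :
  coef_bounded c rad ->
  exists g, forall z, Cmod z < rad -> cser (fun k => c k * z ^ k)%C (g z).
Proof.
intros Hc.
exists (fun z => epsilon (inhabits (RtoC 0)) (fun l => cser (fun k => c k * z ^ k)%C l)).
intros z Hz. apply epsilon_spec.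
destruct (coef_bounded_geom c rad z Hc Hz) as (M & s & Hs & HM).
now apply cser_exists with M s.
Qed.

Lemma coef_bounded_of_pseries (c : nat -> CC) (g : CC -> CC) (rad : R) :
  (forall z, Cmod z < rad -> cser (fun k => c k * z ^ k)%C (g z)) -> coef_bounded c rad.
Proof.
intros Hg r Hr.
assert (Er : Cmod r = r) by (rewrite Cmod_R, Rabs_pos_eq; lra).
destruct (cser_terms_bounded _ _ (Hg r ltac:(lra))) as [M HM].
exists M. intros k. specialize (HM k). now rewrite Cmod_mult, Cmod_pow, Er in HM.
Qed.

(** * The root test and the cohomological equation for [g1] *)

Lemma nroot_pow (x : R) (n : nat) : (1 <= n)%nat -> 0 <= x -> nroot x n ^ n = x /\ 0 <= nroot x n.
Proof.
intros Hn Hx. unfold nroot. destruct Req_EM_T as [-> | Hx0].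
- split; [| lra]. destruct n; [lia | simpl; ring].
- split; [| apply Rlt_le, exp_pos].
  rewrite <- Rpower_pow by apply exp_pos. rewrite Rpower_mult, Rinv_l, Rpower_1; [easy | lra |].
  apply not_0_INR. lia.
Qed.

Lemma g1_coef_mod (a : nat -> CC) (beta : CC) (n : nat) :
  irrational_rotation beta -> (1 <= n)%nat ->
  Cmod (g1_coef a beta n) = Cmod (a n) / Cmod (1 - beta ^ n).
Proof.
intros Hb Hn. destruct n; [lia |]. unfold g1_coef. apply Cmod_div.
apply Cminus_neq_0. intros E. symmetry in E. now apply Hb in E.
Qed.

Lemma root_seq_pow (a : nat -> CC) (beta : CC) (n : nat) :
  irrational_rotation beta -> (1 <= n)%nat ->
  root_seq a beta n ^ n = Cmod (g1_coef a beta n) /\ 0 <= root_seq a beta n.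
Proof.
intros Hb Hn. unfold root_seq. rewrite g1_coef_mod by easy.
apply nroot_pow; [easy |]. rewrite <- g1_coef_mod by easy. apply Cmod_ge_0.
Qed.

Lemma LimSup_seq_is (u : nat -> R) : is_LimSup_seq u (LimSup_seq u).
Proof.
destruct (ex_LimSup_seq u) as [l Hl]. now rewrite (is_LimSup_seq_unique _ _ Hl).
Qed.

(** For [r < 1] the limsup lies below [/ r], so the roots are eventually below [/ r] and the k-th
    coefficient times r^k is eventually at most 1. *)
Lemma coef_bounded_of_LimSup (a : nat -> CC) (beta : CC) :
  irrational_rotation beta ->
  Rbar_le (LimSup_seq (root_seq a beta)) 1 -> coef_bounded (g1_coef a beta) 1.
Proof.
intros Hb HL r Hr. pose proof (LimSup_seq_is (root_seq a beta)) as H.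
assert (Hev : exists N, forall n, (N <= n)%nat -> root_seq a beta n < / r).
{ assert (Hr1 : 1 < / r) by (rewrite <- Rinv_1; apply Rinv_lt_contravar; lra).
  destruct (LimSup_seq (root_seq a beta)) as [l | |]; simpl in HL.
  - assert (He : 0 < / r - l) by lra.
    destruct (H (mkposreal _ He)) as [_ [N HN]]. exists N. intros n Hn.
    specialize (HN n Hn). simpl in HN. lra.
  - easy.
  - apply H. }
destruct Hev as [N HN].
apply (bounded_of_eventually _ 1 (S N)). intros k Hk.
destruct (root_seq_pow a beta k Hb) as [E H0]; [lia |]. specialize (HN k ltac:(lia)).
rewrite <- E, <- Rpow_mult_distr. rewrite <- (pow1 k). apply pow_incr. split.
- apply Rmult_le_pos; lra.
- apply Rlt_le, Rmult_lt_reg_r with (/ r); [apply Rinv_0_lt_compat; lra |].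
  rewrite Rmult_assoc, Rinv_r; lra.
Qed.

(** Some [q > 1] is exceeded by infinitely many roots. The radius [r = 2 / (1 + q)] is below 1 while
    [q r > 1], so the powers of [q r] defeat every bound. *)
Lemma unbounded_of_LimSup (a : nat -> CC) (beta : CC) :
  irrational_rotation beta ->
  Rbar_lt 1 (LimSup_seq (root_seq a beta)) ->
  exists r, 0 < r < 1 /\ forall M, ~ (forall k, Cmod (g1_coef a beta k) * r ^ k <= M).
Proof.
intros Hb HL. pose proof (LimSup_seq_is (root_seq a beta)) as H.
assert (Hfr : exists q, 1 < q /\ forall N, exists n, (N <= n)%nat /\ q < root_seq a beta n).
{ destruct (LimSup_seq (root_seq a beta)) as [l | |]; simpl in HL.
  - exists ((1 + l) / 2). split; [lra |]. intros N.
    assert (He : 0 < (l - 1) / 2) by lra.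
    destruct (H (mkposreal _ He)) as [Hf _]. destruct (Hf N) as (n & Hn & Hu).
    exists n. split; [easy |]. simpl in Hu. lra.
  - exists 2. split; [lra |]. apply H.
  - easy. }
destruct Hfr as (q & Hq & Hf).
assert (Hrq : 1 < 2 * q / (1 + q)) by (apply Rlt_div_r; lra).
exists (2 / (1 + q)). split.
- split; [apply Rdiv_lt_0_compat; lra | apply Rlt_div_l; lra].
- intros M HM.
  destruct (Pow_x_infinity (2 * q / (1 + q))) with (b := M + 1) as [N HN].
  { rewrite Rabs_pos_eq; lra. }
  destruct (Hf (S N)) as (n & Hn & Hu).
  specialize (HN n ltac:(lia)). specialize (HM n).
  destruct (root_seq_pow a beta n Hb) as [E _]; [lia |].
  rewrite Rabs_pos_eq in HN by (apply pow_le; lra).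
  assert (Hle : (2 * q / (1 + q)) ^ n <= M).
  { eapply Rle_trans; [| apply HM].
    rewrite <- E, <- Rpow_mult_distr. apply pow_incr. split; [lra |].
    replace (2 * q / (1 + q)) with (q * (2 / (1 + q))) by (field; lra).
    apply Rmult_le_compat_r; [| lra]. apply Rlt_le, Rdiv_lt_0_compat; lra. }
  lra.
Qed.

(** The denominators of [g1_coef] are made for this: c_k - beta^k c_k = a_k for k >= 1, and the
    index 0 leaves the constant [a O]. *)
Lemma g1_cohomological (beta z : CC) (a : nat -> CC) (l g gb : CC) :
  irrational_rotation beta ->
  cser (fun k => a k * z ^ k)%C l ->
  cser (fun k => g1_coef a beta k * z ^ k)%C g ->
  cser (fun k => g1_coef a beta k * (beta * z) ^ k)%C gb ->
  l = (a O + g - gb)%C.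
Proof.
intros Hb Hl Hg Hgb.
assert (E : (l + - (1) * g + gb)%C = a O).
{ apply (cser_unique (fun k => a k * z ^ k + - (1) * (g1_coef a beta k * z ^ k)
    + g1_coef a beta k * (beta * z) ^ k)%C).
  - apply (cser_plus (fun k => a k * z ^ k + - (1) * (g1_coef a beta k * z ^ k))%C); [| easy].
    apply cser_plus; [easy | now apply cser_scal].
  - apply cser_ext with (fun k => if Nat.eq_dec k 0 then a O else 0).
    + intros k. destruct (Nat.eq_dec k 0) as [-> | Hk]; [simpl; ring |].
      destruct k as [| k]; [easy |]. unfold g1_coef.
      rewrite Cpow_mult_l. field.
      apply Cminus_neq_0. intros E. symmetry in E. apply Hb in E; [easy | lia].
    + intros eps He. exists 1%nat. intros n Hn. rewrite csum_single.
      destruct le_dec; [lia |]. replace (a O - a O)%C with (RtoC 0) by ring.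
      rewrite Cmod_0. lra. }
rewrite <- E. ring.
Qed.

(** * Eigenfunctions on circles *)

(** Continuity is joint in the angle and the radius, so that values on a circle can be compared
    uniformly with those on nearby circles. *)
Lemma Cmod_polar_continuous (f : CC -> CC) (t r : R) (l : CC) :
  cdiff f (r * cos t, r * sin t) l ->
  continuity_2d_pt (fun x y => Cmod (f (y * cos x, y * sin x))) t r.
Proof.
intros Hf eps.
destruct (cdiff_continuous f _ l eps Hf (cond_pos eps)) as (d & Hd & Hw).
assert (Hd2 : 0 < d / 2) by lra.
assert (Hc : continuity_2d_pt (fun x y => y * cos x) t r).
{ apply continuity_2d_pt_mult; [apply continuity_2d_pt_id2 |].
  apply (continuity_1d_2d_pt_comp cos (fun x _ => x)); [apply continuity_cos |].
  apply continuity_2d_pt_id1. }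
assert (Hs : continuity_2d_pt (fun x y => y * sin x) t r).
{ apply continuity_2d_pt_mult; [apply continuity_2d_pt_id2 |].
  apply (continuity_1d_2d_pt_comp sin (fun x _ => x)); [apply continuity_sin |].
  apply continuity_2d_pt_id1. }
specialize (Hc (mkposreal _ Hd2)). specialize (Hs (mkposreal _ Hd2)). simpl in Hc, Hs.
eapply locally_2d_impl; [| exact Hs]. eapply locally_2d_impl; [| exact Hc].
apply locally_2d_forall.
intros x y Hcx Hsx.
assert (Hlt : Cmod ((y * cos x, y * sin x) - (r * cos t, r * sin t)) < d).
{ eapply Rle_lt_trans; [apply Cmod_le_re_im |]. unfold Re, Im. simpl.
  unfold Rminus in Hcx, Hsx. lra. }
specialize (Hw _ Hlt).
apply Rle_lt_trans with (Cmod (f (y * cos x, y * sin x) - f (r * cos t, r * sin t))); [| easy].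
apply Rabs_le. split.
- pose proof (Cmod_triangle_inv (f (r * cos t, r * sin t)) (f (y * cos x, y * sin x))) as H.
  rewrite Cmod_minus_sym in H. lra.
- apply Cmod_triangle_inv.
Qed.

Lemma Cmod_polar (r t : R) : 0 <= r -> Cmod (r * cos t, r * sin t) = r.
Proof.
intros Hr. unfold Cmod. simpl.
pose proof (sin2_cos2 t) as E. unfold Rsqr in E.
replace (r * cos t * (r * cos t * 1) + r * sin t * (r * sin t * 1))
  with (r * r * (sin t * sin t + cos t * cos t)) by ring.
rewrite E, Rmult_1_r. now apply sqrt_square.
Qed.

(** By compactness of the range of angles, the modulus of [f] has a maximum and a positive minimum
    on the circle. *)
Lemma log_modulus_bounded (f : CC -> CC) (r : R) :
  0 <= r ->
  (forall z, Cmod z = r -> exists l, cdiff f z l) ->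
  (forall z, Cmod z = r -> f z <> 0) ->
  exists B, forall z, Cmod z = r -> Rabs (ln (Cmod (f z))) <= B.
Proof.
intros Hr Hd Hnz.
set (F := fun t => Cmod (f (r * cos t, r * sin t))).
assert (HF : forall t, - PI <= t <= PI -> continuity_pt F t).
{ intros t _. apply continuity_pt_locally. intros eps.
  destruct (Hd (r * cos t, r * sin t)) as [l Hl]; [now apply Cmod_polar |].
  destruct (Cmod_polar_continuous f t r l Hl eps) as [d H].
  exists d. intros x Hx. apply (H x r); [exact Hx |].
  rewrite Rminus_diag, Rabs_R0. apply cond_pos. }
pose proof PI_RGT_0 as Hpi.
destruct (continuity_ab_maj F (- PI) PI) as (u & Hu & _); [lra | easy |].
destruct (continuity_ab_min F (- PI) PI) as (v & Hv & _); [lra | easy |].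
assert (Hpos : forall t, 0 < F t) by (intros t; apply Cmod_gt_0, Hnz, Cmod_polar, Hr).
exists (Rabs (ln (F u)) + Rabs (ln (F v))). intros z Hz.
destruct (polar_form z) as (t & Ht & E). rewrite Hz in E.
assert (EF : Cmod (f z) = F t) by (unfold F; now rewrite <- E).
rewrite EF. specialize (Hu t Ht). specialize (Hv t Ht).
assert (Hln : ln (F v) <= ln (F t) <= ln (F u)).
{ split; apply ln_le; auto. }
pose proof (Rle_abs (ln (F u))). pose proof (Rle_abs (- ln (F v))) as H0.
rewrite Rabs_Ropp in H0.
pose proof (Rabs_pos (ln (F u))). pose proof (Rabs_pos (ln (F v))).
apply Rabs_le. lra.
Qed.

(** Since [mm] has no zero on the circle, a zero of [f] propagates along its forward orbit, which is
    dense in the circle; continuity would then give [f z0 = 0]. *)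
Lemma circle_nonvanishing (beta lam : CC) (f mm : CC -> CC) (z0 z l : CC) :
  irrational_rotation beta ->
  (forall x, Cmod x = Cmod z0 -> mm x <> 0) ->
  (forall x, Cmod x = Cmod z0 -> (lam * f x)%C = (mm x * f (beta * x))%C) ->
  cdiff f z0 l -> f z0 <> 0 -> Cmod z = Cmod z0 -> f z <> 0.
Proof.
intros Hb Hmm Heq Hl H0 Hz Hfz.
destruct (Ceq_dec z0 0) as [E0 | E0].
{ rewrite E0, Cmod_0 in Hz. apply Cmod_eq_0 in Hz. congruence. }
assert (Hz0 : 0 < Cmod z0) by now apply Cmod_gt_0.
assert (Hzn : z <> 0) by (apply Cmod_gt_0; lra).
assert (Horb : forall n, f (beta ^ n * z)%C = 0 /\ Cmod (beta ^ n * z) = Cmod z0).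
{ intros n. induction n as [| n [IH1 IH2]]; simpl; [now rewrite Cmult_1_l |].
  rewrite <- !Cmult_assoc. split.
  - apply NNPP. intros Hne. specialize (Heq _ IH2). rewrite IH1, Cmult_0_r in Heq.
    symmetry in Heq. revert Heq. now apply Cmult_neq_0; [apply Hmm |].
  - rewrite Cmod_mult, IH2, (proj1 Hb). lra. }
destruct (cdiff_continuous f z0 l (Cmod (f z0)) Hl) as (d & Hd & Hw);
  [now apply Cmod_gt_0 |].
destruct (orbit_dense beta (z0 / z) (d / Cmod z0) Hb) as [n Hn].
- rewrite Cmod_div, Hz by easy. field. lra.
- now apply Rdiv_lt_0_compat.
- specialize (Hw (beta ^ n * z)%C). rewrite (proj1 (Horb n)) in Hw.
  replace (0 - f z0)%C with (- f z0)%C in Hw by ring. rewrite Cmod_opp in Hw.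
  assert (Hlt : Cmod (beta ^ n * z - z0) < d).
  { replace (beta ^ n * z - z0)%C with ((beta ^ n - z0 / z) * z)%C by (field; easy).
    rewrite Cmod_mult, Hz. now apply Rlt_div_r. }
  specialize (Hw Hlt). lra.
Qed.

(* Taking moduli, [u = ln |f|] solves the cohomological equation
   [Re m1 = ln |lam| + u - u (beta .)] on the circle; compare [k]-th Fourier coefficients. *)
Lemma cohomological_coef_bound (beta : CC) (a p : nat -> CC) (u : nat -> R) (z : CC)
    (M s L B : R) (k : nat) :
  irrational_rotation beta -> 0 <= s < 1 ->
  (forall l, Cmod (a l * z ^ l) <= M * s ^ l) ->
  (forall j, cser (fun l => a l * (beta ^ j * z) ^ l)%C (p j)) ->
  (forall j, Re (p j) = L + u j - u (S j)) ->
  (forall j, Rabs (u j) <= B) ->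
  (1 <= k)%nat ->
  Cmod (a k * z ^ k) <= 2 * B * Cmod (1 - beta ^ k).
Proof.
intros Hb Hs Ha Hp Hu HB Hk.
pose proof (proj1 Hb) as Hb1.
(* [q] is the inverse of [beta^k]: averaging against [q^j] extracts the term of index [k]. *)
set (q := Cconj (beta ^ k)).
assert (Hbk : Cmod (beta ^ k) = 1) by now apply Cmod_pow_unit.
assert (Hq : Cmod q = 1) by (unfold q; now rewrite Cmod_conj).
assert (Hbq : (beta ^ k * q)%C = 1) by now apply unit_conj_mult.
assert (Hq1 : q <> 1).
{ intros E. apply (proj2 Hb k Hk). now rewrite E, Cmult_1_r in Hbq. }
assert (Hm1 : mean (fun j => q ^ j * p j)%C (a k * z ^ k)).
{ replace (a k * z ^ k)%C with (a k * z ^ k * 1)%C by ring.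
  apply (mean_pseries beta q z 1 a p M s k); try easy.
  - intros l Hl E. apply Hl, (rotation_pow_inj beta _ _ Hb).
    transitivity (beta ^ k * (q * beta ^ l))%C.
    + rewrite Cmult_assoc, Hbq. ring.
    + rewrite E. ring.
  - apply mean_ext with (fun _ => RtoC 1); [| apply mean_const].
    intros j. now rewrite (Cmult_comm q), Hbq, Cpow_1_l. }
(* After conjugation the term [l] rotates by [beta^(k + l)], never 1 as [k >= 1]. So passing from
   [p] to twice its real part does not change the extracted mean. *)
assert (Hm2 : mean (fun j => q ^ j * Cconj (p j))%C 0).
{ assert (H : mean (fun j => (beta ^ k) ^ j * p j)%C (a O * z ^ 0 * 0)).
  { apply (mean_pseries beta (beta ^ k) z 0 a p M s O); try easy.
    - intros l Hl. rewrite <- Cpow_add_r. apply Hb. lia.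
    - apply mean_ext with (fun j => (beta ^ k) ^ j)%C.
      + intros j. f_equal. simpl. ring.
      + apply mean_geom; [easy | now apply Hb]. }
  apply mean_conj in H. rewrite Cmult_0_r in H.
  replace (Cconj 0) with (RtoC 0) in H by (apply injective_projections; simpl; ring).
  apply mean_ext with (2 := H). intros j. unfold q. now rewrite Cmult_conj, Cpow_conj. }
assert (Hm3 : mean (fun j => q ^ j * (2 * Re (p j)))%C (a k * z ^ k)).
{ replace (a k * z ^ k)%C with (a k * z ^ k + 0)%C by ring.
  apply mean_ext with (2 := mean_plus _ _ _ _ Hm1 Hm2). intros j.
  rewrite (re_alt (p j)). field. }
assert (Hm4 : mean (fun j => - (2 * L) * q ^ j)%C (- (2 * L) * 0)).
{ now apply mean_scal, mean_geom. }
set (v := fun j => (q ^ j * u j)%C).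
assert (HuB : forall j, Cmod (v j) <= B).
{ intros j. unfold v. rewrite Cmod_mult, Cmod_pow_unit, Cmod_R by easy.
  specialize (HB j). lra. }
(* Summation by parts: adding this telescoping sequence of mean zero cancels the terms in [u (S j)]
   and leaves [2 (1 - beta^k) v j], which is bounded by the required constant. *)
assert (Hm5 : mean (fun j => - (2 * beta ^ k) * (v j - v (S j)))%C (- (2 * beta ^ k) * 0)).
{ apply mean_scal, mean_of_bounded_sums with (2 * B). intros n.
  rewrite csum_telescope. eapply Rle_trans; [apply Cmod_minus_triangle |].
  pose proof (HuB O). pose proof (HuB n). lra. }
pose proof (mean_plus _ _ _ _ (mean_plus _ _ _ _ Hm3 Hm4) Hm5) as Hm6.
replace (a k * z ^ k + - (2 * L) * 0 + - (2 * beta ^ k) * 0)%C with (a k * z ^ k)%C in Hm6 by ring.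
apply mean_bound with (2 := Hm6). intros j. cbv beta.
replace (q ^ j * (2 * Re (p j)) + - (2 * L) * q ^ j + - (2 * beta ^ k) * (v j - v (S j)))%C
  with (2 * (1 - beta ^ k) * v j)%C.
- rewrite !Cmod_mult, Cmod_R, Rabs_pos_eq by lra. specialize (HuB j).
  pose proof (Cmod_ge_0 (1 - beta ^ k)). nra.
- rewrite Hu. unfold v. simpl Cpow. rewrite RtoC_minus, RtoC_plus.
  replace (q ^ j * (2 * (L + u j - u (S j))) + - (2 * L) * q ^ j
      + - (2 * beta ^ k) * (q ^ j * u j - q * q ^ j * u (S j)))%C
    with (2 * q ^ j * (u j - u (S j)) - 2 * beta ^ k * q ^ j * u j
      + 2 * (beta ^ k * q) * q ^ j * u (S j))%C by ring.
  rewrite Hbq. ring.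
Qed.

(** * Eigenfunctions on discs *)

(** Exponentiating the cohomological equation shows that [cexp (g z)] satisfies the eigenvalue
    equation for [cexp (a O)]. *)
Lemma g1_cocycle (beta z : CC) (a : nat -> CC) (m1 g : CC -> CC) :
  irrational_rotation beta ->
  cser (fun k => a k * z ^ k)%C (m1 z) ->
  cser (fun k => g1_coef a beta k * z ^ k)%C (g z) ->
  cser (fun k => g1_coef a beta k * (beta * z) ^ k)%C (g (beta * z)%C) ->
  (cexp (m1 z) * cexp (g (beta * z)))%C = (cexp (a O) * cexp (g z))%C.
Proof.
intros Hb Hm Hg Hgb.
rewrite (g1_cohomological beta z a (m1 z) (g z) (g (beta * z)%C) Hb Hm Hg Hgb).
rewrite <- !cexp_plus. f_equal. ring.
Qed.

Lemma Cmod_rotate (beta z : CC) : Cmod beta = 1 -> Cmod (beta * z) = Cmod z.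
Proof. intros H. rewrite Cmod_mult, H. ring. Qed.

(** Dividing by [cexp (g z)] leaves an eigenfunction of the pure rotation, hence a monomial. The
    radius is a parameter because part (a) uses the unit disc and part (b) a smaller one. *)
Lemma eigenfunction_form (beta lam : CC) (a : nat -> CC) (m1 g f : CC -> CC) (rad : R) (z1 : CC) :
  irrational_rotation beta ->
  (forall z, Cmod z < rad -> cser (fun k => a k * z ^ k)%C (m1 z)) ->
  (forall z, Cmod z < rad -> cser (fun k => g1_coef a beta k * z ^ k)%C (g z)) ->
  (forall z, Cmod z < rad -> exists l, cdiff f z l) ->
  (forall z, Cmod z < rad -> (lam * f z)%C = (cexp (m1 z) * f (beta * z))%C) ->
  Cmod z1 < rad -> f z1 <> 0 ->
  exists (n : nat) (c : CC), c <> 0 /\ lam = (cexp (a O) * beta ^ n)%C /\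
    forall z, Cmod z < rad -> f z = (c * (z ^ n * cexp (g z)))%C.
Proof.
intros Hb Hm Hg Hf Heq Hz1 Hf1.
assert (Hrot : forall z, Cmod (beta * z) = Cmod z) by (intros z; apply Cmod_rotate, Hb).
assert (Hcoc : forall z, Cmod z < rad ->
  (cexp (m1 z) * cexp (g (beta * z)))%C = (cexp (a O) * cexp (g z))%C).
{ intros z Hz. apply g1_cocycle; auto. apply Hg. now rewrite Hrot. }
pose proof (cexp_neq_0 (a O)) as Ha0.
set (h := fun z => (f z * cexp (- (1) * g z))%C).
assert (Hfh : forall z, f z = (h z * cexp (g z))%C).
{ intros z. unfold h. rewrite <- Cmult_assoc, (Cmult_comm (cexp _)).
  replace (- (1) * g z)%C with (- g z)%C by ring. rewrite cexp_opp. ring. }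
assert (Hheq : forall z, Cmod z < rad -> h (beta * z)%C = (lam / cexp (a O) * h z)%C).
{ intros z Hz. specialize (Hcoc z Hz). specialize (Heq z Hz).
  rewrite !Hfh in Heq.
  assert (E : (cexp (a O) * cexp (g z) * h (beta * z))%C = (lam * (h z * cexp (g z)))%C).
  { rewrite <- Hcoc, Heq. ring. }
  pose proof (cexp_neq_0 (g z)) as Hg0.
  transitivity (cexp (a O) * cexp (g z) * h (beta * z) / (cexp (a O) * cexp (g z)))%C;
    [field; easy |].
  rewrite E. field. easy. }
destruct (rotation_eigen_monomial beta (lam / cexp (a O)) rad h z1) as (n & c & Hc & Hh);
  try easy.
- intros z Hz. destruct (Hf z Hz) as [l Hl].
  destruct (pseries_cdiff _ g rad (coef_bounded_of_pseries _ g rad Hg) Hg z Hz) as [l' Hl'].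
  eexists. apply cdiff_mult; [exact Hl |].
  apply (cdiff_comp cexp); [apply cdiff_cexp | apply cdiff_scal, Hl'].
- unfold h. apply Cmult_neq_0; [easy | apply cexp_neq_0].
- exists n, c. split; [easy |]. split.
  + assert (Hr : 0 < rad) by (pose proof (Cmod_ge_0 z1); lra).
    (* The eigenvalue is read off at a point where the monomial does not vanish. *)
    set (x := RtoC (rad / 2)).
    assert (Hx : Cmod x < rad) by (unfold x; rewrite Cmod_R, Rabs_pos_eq; lra).
    assert (Hx0 : (x ^ n)%C <> 0).
    { apply Cpow_nz, Cmod_gt_0. unfold x. rewrite Cmod_R, Rabs_pos_eq; lra. }
    pose proof (Hheq x Hx) as E. rewrite !Hh in E by (rewrite ?Hrot; easy).
    rewrite Cpow_mult_l in E.
    transitivity (lam / cexp (a O) * (c * x ^ n) * (cexp (a O) / (c * x ^ n)))%C;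
      [field; easy |].
    rewrite <- E. field. easy.
  + intros z Hz. rewrite Hfh, (Hh z Hz). ring.
Qed.

Lemma nonzero_nearby (f : CC -> CC) (z l : CC) (rad : R) :
  cdiff f z l -> f z <> 0 -> Cmod z < rad ->
  exists w : CC, w <> 0 /\ Cmod w < rad /\ f w <> 0.
Proof.
intros Hl Hf Hz. destruct (Ceq_dec z 0) as [-> | Hz0]; [| now exists z].
rewrite Cmod_0 in Hz.
destruct (cdiff_continuous f 0 l (Cmod (f 0)) Hl) as (d & Hd & Hw); [now apply Cmod_gt_0 |].
assert (Hx : 0 < Rmin d rad) by now apply Rmin_glb_lt.
pose proof (Rmin_l d rad). pose proof (Rmin_r d rad).
exists (RtoC (Rmin d rad / 2)).
assert (E : Cmod (RtoC (Rmin d rad / 2)) = Rmin d rad / 2) by (rewrite Cmod_R, Rabs_pos_eq; lra).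
split; [apply Cmod_gt_0; lra | split; [lra |]].
intros E0. specialize (Hw (RtoC (Rmin d rad / 2))). rewrite E0 in Hw.
replace (RtoC (Rmin d rad / 2) - 0)%C with (RtoC (Rmin d rad / 2)) in Hw by ring.
replace (0 - f 0)%C with (- f 0)%C in Hw by ring. rewrite Cmod_opp in Hw.
specialize (Hw ltac:(lra)). lra.
Qed.

(** One nonzero value makes [f] zero-free on the whole circle, so [ln |f|] is a bounded solution of
    the real cohomological equation along the orbit. *)
Lemma eigenfunction_coef_bound (beta lam z : CC) (a : nat -> CC) (m1 f : CC -> CC) :
  irrational_rotation beta ->
  (forall x, inD x -> cser (fun k => a k * x ^ k)%C (m1 x)) ->
  (forall x, inD x -> exists l, cdiff f x l) ->
  (forall x, inD x -> (lam * f x)%C = (cexp (m1 x) * f (beta * x))%C) ->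
  inD z -> f z <> 0 ->
  exists M, forall k, Cmod (g1_coef a beta k) * Cmod z ^ k <= M.
Proof.
intros Hb Hm Hf Heq Hz Hfz. unfold inD in *.
assert (Hnz : forall x, Cmod x = Cmod z -> f x <> 0).
{ intros x Hx. destruct (Hf z Hz) as [l Hl].
  apply (circle_nonvanishing beta lam f (fun x => cexp (m1 x)) z x l); try easy.
  - intros y _. apply cexp_neq_0.
  - intros y Hy. apply Heq. lra. }
destruct (log_modulus_bounded f (Cmod z)) as [B HB];
  [apply Cmod_ge_0 | intros x Hx; apply Hf; lra | easy |].
assert (Hrot : forall j, Cmod (beta ^ j * z) = Cmod z).
{ intros j. rewrite Cmod_mult, Cmod_pow_unit by apply Hb. ring. }
assert (Hlam : lam <> 0).
{ intros E. specialize (Heq z Hz). rewrite E, Cmult_0_l in Heq. symmetry in Heq.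
  revert Heq. apply Cmult_neq_0; [apply cexp_neq_0 |].
  apply Hnz, Cmod_rotate, Hb. }
destruct (coef_bounded_geom a 1 z (coef_bounded_of_pseries a m1 1 Hm) Hz) as (M & s & Hs & HM).
(* The index 0, where [1 - beta^k] vanishes, is set aside as a finite exception. *)
apply (bounded_of_eventually _ (2 * B) 1). intros k Hk.
assert (Hbk : (1 - beta ^ k)%C <> 0).
{ apply Cminus_neq_0. intros E. symmetry in E. now apply Hb in E. }
rewrite g1_coef_mod by easy.
apply Cmod_gt_0 in Hbk.
replace (Cmod (a k) / Cmod (1 - beta ^ k) * Cmod z ^ k)
  with (Cmod (a k * z ^ k) / Cmod (1 - beta ^ k))
  by (rewrite Cmod_mult, Cmod_pow; field; lra).
apply Rle_div_l; [easy |].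
apply (cohomological_coef_bound beta a (fun j => m1 (beta ^ j * z)%C)
  (fun j => ln (Cmod (f (beta ^ j * z)%C))) z M s (ln (Cmod lam)) B k); try easy.
- intros j. apply Hm. rewrite Hrot. easy.
- intros j. cbv beta.
  assert (E := Heq (beta ^ j * z)%C ltac:(rewrite Hrot; easy)).
  replace (beta * (beta ^ j * z))%C with (beta ^ S j * z)%C in E by (simpl; ring).
  apply (f_equal Cmod) in E. rewrite !Cmod_mult, Cmod_cexp in E.
  rewrite <- Cmod_mult in E.
  apply (f_equal ln) in E.
  rewrite Cmod_mult, !ln_mult in E.
  + rewrite ln_exp in E. lra.
  + apply exp_pos.
  + apply Cmod_gt_0, Hnz, Hrot.
  + now apply Cmod_gt_0.
  + apply Cmod_gt_0, Hnz, Hrot.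
- intros j. apply HB, Hrot.
Qed.

Lemma no_eigenfunction (beta lam z1 : CC) (a : nat -> CC) (m1 f : CC -> CC) (r0 : R) :
  irrational_rotation beta ->
  (forall x, inD x -> cser (fun k => a k * x ^ k)%C (m1 x)) ->
  (forall x, inD x -> exists l, cdiff f x l) ->
  (forall x, inD x -> (lam * f x)%C = (cexp (m1 x) * f (beta * x))%C) ->
  0 < r0 < 1 ->
  (forall M, ~ (forall k, Cmod (g1_coef a beta k) * r0 ^ k <= M)) ->
  inD z1 -> f z1 = 0.
Proof.
intros Hb Hm Hf Heq Hr0 Hunb Hz1. apply NNPP. intros Hfz1.
destruct (Hf z1 Hz1) as [l1 Hl1].
destruct (nonzero_nearby f z1 l1 1 Hl1 Hfz1 Hz1) as (z2 & Hz20 & Hz2 & Hfz2).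
clear z1 Hz1 Hfz1 l1 Hl1. unfold inD in *.
(* Each such radius satisfies the coefficient bound, so none exceeds [r0]; the supremum [R0] is the
   radius of the smallest closed disc outside which [f] vanishes. *)
set (radii := fun r => exists z, Cmod z = r /\ r < 1 /\ f z <> 0).
assert (Hbd : forall r, radii r -> exists M, forall k, Cmod (g1_coef a beta k) * r ^ k <= M).
{ intros r (z & <- & Hz & Hfz).
  apply (eigenfunction_coef_bound beta lam z a m1 f Hb Hm Hf Heq); easy. }
assert (Hpow : forall c r r' k, 0 <= r <= r' -> Cmod c * r ^ k <= Cmod c * r' ^ k).
{ intros c r r' k Hr. apply Rmult_le_compat_l; [apply Cmod_ge_0 | now apply pow_incr]. }
assert (HSr0 : forall r, radii r -> r <= r0).
{ intros r Hr. apply Rnot_lt_le. intros Hlt. destruct (Hbd r Hr) as [M HM].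
  apply (Hunb M). intros k. eapply Rle_trans; [| apply HM]. apply Hpow. lra. }
assert (HS2 : radii (Cmod z2)) by now exists z2.
destruct (completeness radii) as [R0 [Hub Hlub]].
{ exists r0. exact HSr0. }
{ now exists (Cmod z2). }
assert (HR0 : 0 < R0).
{ apply Rlt_le_trans with (Cmod z2); [now apply Cmod_gt_0 | now apply Hub]. }
assert (HR1 : R0 < 1) by (apply Rle_lt_trans with r0; [now apply Hlub | easy]).
assert (Hcb : coef_bounded (g1_coef a beta) R0).
{ intros r Hr.
  assert (Hex : exists r', radii r' /\ r < r').
  { apply NNPP. intros Hno.
    assert (R0 <= r); [| lra]. apply Hlub. intros r' Hr'. apply Rnot_lt_le.
    intros Hlt. apply Hno. now exists r'. }
  destruct Hex as (r' & HS' & Hlt). destruct (Hbd r' HS') as [M HM].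
  exists M. intros k. eapply Rle_trans; [| apply HM]. apply Hpow. lra. }
assert (Hout : forall z, R0 < Cmod z < 1 -> f z = 0).
{ intros z Hz. apply NNPP. intros Hne.
  assert (Cmod z <= R0); [| lra]. apply Hub. now exists z. }
assert (Hcirc : forall z, Cmod z = R0 -> f z = 0).
{ intros z Hz. apply NNPP. intros Hne.
  destruct (Hf z) as [l Hl]; [lra |].
  destruct (cdiff_continuous f z l (Cmod (f z)) Hl) as (d & Hd & Hw); [now apply Cmod_gt_0 |].
  (* A radial step outwards lands where [f] vanishes but stays inside the unit disc and within [d]
     of [z]. *)
  set (e := Rmin (d / 2) ((1 - R0) / 2)).
  assert (He : 0 < e) by (apply Rmin_glb_lt; lra).
  assert (Hed : e <= d / 2) by apply Rmin_l.
  assert (Her : e <= (1 - R0) / 2) by apply Rmin_r.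
  specialize (Hw (z + e * z)%C).
  replace (z + e * z - z)%C with (e * z)%C in Hw by ring.
  rewrite Cmod_mult, Cmod_R, (Rabs_pos_eq e), Hz in Hw by lra.
  specialize (Hw ltac:(nra)).
  rewrite (Hout (z + e * z)%C) in Hw.
  - replace (0 - f z)%C with (- f z)%C in Hw by ring. rewrite Cmod_opp in Hw. lra.
  - replace (z + e * z)%C with ((1 + e)%R * z)%C by (rewrite RtoC_plus; ring).
    rewrite Cmod_mult, Cmod_R, Rabs_pos_eq, Hz by lra. nra. }
assert (Hz2R : Cmod z2 < R0).
{ destruct (Hub _ HS2) as [H | H]; [easy |]. now apply Hcirc in H. }
destruct (pseries_sum_exists _ R0 Hcb) as [g Hg].
destruct (eigenfunction_form beta lam a m1 g f R0 z2) as (n & c & Hc & _ & Hform); try easy.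
{ intros z Hz. apply Hm. lra. }
{ intros z Hz. apply Hf. lra. }
{ intros z Hz. apply Heq. lra. }
assert (Hcm : 0 < Cmod c) by now apply Cmod_gt_0.
(* On a circle of radius [r >= R0 / 2], a modulus of c z^n exp(g) below this threshold forces
   [Re g < -1]. *)
assert (Heps : 0 < Cmod c * (R0 / 2) ^ n * exp (- 1)).
{ apply Rmult_lt_0_compat; [| apply exp_pos].
  apply Rmult_lt_0_compat; [easy | apply pow_lt; lra]. }
(* Uniform continuity in the angle yields an entire circle just inside radius [R0] on which [f] is
   below the threshold. *)
destruct (uniform_continuity_2d_1d
  (fun x y => Cmod (f (y * cos x, y * sin x))) (- PI) PI R0) with (eps := mkposreal _ Heps)
  as [d Hd].
{ intros t _. destruct (Hf (R0 * cos t, R0 * sin t)) as [l Hl].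
  - rewrite Cmod_polar; lra.
  - now apply Cmod_polar_continuous with l. }
simpl in Hd. pose proof (cond_pos d) as Hd0.
set (r := R0 - Rmin (d / 2) (R0 / 2)).
assert (Hr : R0 / 2 <= r < R0 /\ R0 - d <= r).
{ unfold r. pose proof (Rmin_l (d / 2) (R0 / 2)). pose proof (Rmin_r (d / 2) (R0 / 2)).
  assert (0 < Rmin (d / 2) (R0 / 2)) by (apply Rmin_glb_lt; lra). lra. }
assert (Hsmall : forall z, Cmod z = r -> Cmod (f z) < Cmod c * (R0 / 2) ^ n * exp (- 1)).
{ intros z Hz. destruct (polar_form z) as (t & Ht & E). rewrite Hz in E.
  specialize (Hd t R0 t r Ht ltac:(lra) Ht ltac:(lra)).
  rewrite Rminus_diag, Rabs_R0 in Hd. specialize (Hd Hd0).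
  rewrite <- E, (Hcirc (R0 * cos t, R0 * sin t)), Cmod_0, Rminus_0_r in Hd
    by (apply Cmod_polar; lra).
  rewrite Rabs_pos_eq in Hd by apply Cmod_ge_0. exact Hd. }
assert (Er : Cmod r = r) by (rewrite Cmod_R, Rabs_pos_eq; lra).
assert (Horb : forall j, Cmod (beta ^ j * r) = r).
{ intros j. rewrite Cmod_mult, Cmod_pow_unit, Er by apply Hb. ring. }
assert (Hre : forall j, Re (1 ^ j * g (beta ^ j * r)%C) <= - 1).
{ intros j. rewrite Cpow_1_l, Cmult_1_l.
  generalize (Horb j). generalize (beta ^ j * r)%C. intros z Hz.
  specialize (Hsmall z Hz). rewrite Hform in Hsmall by lra.
  rewrite !Cmod_mult, Cmod_cexp, Cmod_pow, Hz in Hsmall.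
  apply Rlt_le, exp_lt_inv.
  assert (Hrn : Cmod c * (R0 / 2) ^ n <= Cmod c * r ^ n) by (apply Hpow; lra).
  pose proof (exp_pos (- 1)).
  assert (Hrp : 0 < Cmod c * r ^ n)
    by (apply Rmult_lt_0_compat; [easy | apply pow_lt; lra]).
  apply Rmult_lt_reg_l with (Cmod c * r ^ n); [easy |]. nra. }
destruct (coef_bounded_geom _ R0 r Hcb) as (M & s & Hs & HM); [lra |].
assert (Hmean : mean (fun j => 1 ^ j * g (beta ^ j * r)%C)%C (g1_coef a beta 0 * r ^ 0 * 1)).
{ apply (mean_pseries beta 1 r 1 (g1_coef a beta) (fun j => g (beta ^ j * r)%C) M s 0);
    try easy.
  - apply Hb.
  - apply Cmod_1.
  - intros j. apply Hg. rewrite Horb. easy.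
  - intros l Hl. rewrite Cmult_1_l. apply Hb. lia.
  - apply mean_ext with (fun _ => RtoC 1); [| apply mean_const].
    intros j. simpl (beta ^ 0)%C. rewrite Cmult_1_l, Cpow_1_l. easy. }
(* The mean is the constant coefficient of [g1], which is 0, while every term has real part at most
   -1. *)
apply (mean_re_bound _ _ (- 1) Hre) in Hmean.
unfold Re in Hmean. simpl in Hmean. lra.
Qed.

Theorem theorem3p7 (beta : CC) (m m1 : CC -> CC) (a : nat -> CC)
  (Hbeta1 : Cmod beta = 1%R)
  (Hbeta : forall n : nat, (1 <= n)%nat -> Cpow beta n <> RtoC 1)
  (Hm : Hol m)
  (Hm0 : forall z, inD z -> m z <> RtoC 0)
  (Hm1 : Hol m1)
  (Hexp : forall z, inD z -> m z = cexp (m1 z))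
  (Ha : forall z, inD z -> Cpseries a z (m1 z)) :
  (Rbar_le (LimSup_seq (root_seq a beta)) (Finite 1%R) ->
     (forall lam : CC,
        point_spectrum (Top m beta) lam <->
        exists n : nat, lam = Cmult (m (RtoC 0)) (Cpow beta n)) /\
     exists g1 : CC -> CC,
       (forall z, inD z -> Cpseries (g1_coef a beta) z (g1 z)) /\
       forall n : nat,
         let lam := Cmult (m (RtoC 0)) (Cpow beta n) in
         let fn := fun z => Cmult (Cpow z n) (cexp (g1 z)) in
         Hol fn /\
         (exists z, inD z /\ fn z <> RtoC 0) /\
         (forall z, inD z -> Top m beta fn z = Cmult lam (fn z)) /\
         (forall g : CC -> CC, Hol g ->
            (forall z, inD z -> Top m beta g z = Cmult lam (g z)) ->
            exists c : CC, forall z, inD z -> g z = Cmult c (fn z))) /\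
  (Rbar_lt (Finite 1%R) (LimSup_seq (root_seq a beta)) ->
     forall lam : CC, ~ point_spectrum (Top m beta) lam).
Proof.
assert (Hb : irrational_rotation beta) by (split; easy).
assert (Hser : forall z, inD z -> cser (fun k => a k * z ^ k)%C (m1 z)).
{ intros z Hz. now apply Cpseries_cser, Ha. }
assert (Hrot : forall z, inD z -> inD (beta * z)%C).
{ intros z Hz. unfold inD. now rewrite Cmod_rotate. }
assert (H0 : inD 0) by (unfold inD; rewrite Cmod_0; lra).
assert (Em0 : m 0 = cexp (a O)).
{ rewrite (Hexp 0 H0). f_equal. apply (cser_unique _ _ _ (Hser 0 H0)).
  intros eps He. exists 1%nat. intros n Hn.
  rewrite (csum_ext _ (fun l => if Nat.eq_dec l 0 then a O else 0)), csum_single.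
  - destruct le_dec; [lia |]. replace (a O - a O)%C with (RtoC 0) by ring.
    rewrite Cmod_0. lra.
  - intros k. destruct (Nat.eq_dec k 0) as [-> | Hk]; [simpl; ring |].
    destruct k; [easy |]. simpl. ring. }
(* Failure of injectivity is given by two functions; by linearity their difference is an
   eigenfunction that is nonzero somewhere in the disc. *)
assert (Hdiff : forall lam, point_spectrum (Top m beta) lam -> exists (f : CC -> CC) (z1 : CC),
  inD z1 /\ f z1 <> 0 /\ (forall z, inD z -> exists l, cdiff f z l) /\
  (forall z, inD z -> (lam * f z)%C = (cexp (m1 z) * f (beta * z))%C)).
{ intros lam (f & g & Hf & Hg & (z1 & Hz1 & Hne) & Heq).
  exists (fun z => f z + - (1) * g z)%C, z1. repeat split.
  - easy.
  - intros E. apply Hne. replace (f z1) with (f z1 + - (1) * g z1 + g z1)%C by ring.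
    rewrite E. ring.
  - intros z Hz. destruct (proj1 (Hol_cdiff f) Hf z Hz) as [l Hl].
    destruct (proj1 (Hol_cdiff g) Hg z Hz) as [l' Hl'].
    eexists. apply cdiff_plus; [exact Hl | apply cdiff_scal, Hl'].
  - intros z Hz. specialize (Heq z Hz). unfold Top in Heq.
    rewrite <- (Hexp z Hz).
    transitivity (lam * f z - m z * f (beta * z) - (lam * g z - m z * g (beta * z))
      + m z * (f (beta * z) + - (1) * g (beta * z)))%C; [ring |].
    rewrite Heq. ring. }
split.
- intros HL. pose proof (coef_bounded_of_LimSup a beta Hb HL) as Hcb.
  destruct (pseries_sum_exists _ 1 Hcb) as [g Hg].
  assert (Hhol : forall n, Hol (fun z => z ^ n * cexp (g z))%C).
  { intros n. apply Hol_cdiff. intros z Hz.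
    destruct (cdiff_pow n z) as [l Hl].
    destruct (pseries_cdiff _ g 1 Hcb Hg z Hz) as [l' Hl'].
    eexists. apply cdiff_mult; [exact Hl |].
    apply (cdiff_comp cexp); [apply cdiff_cexp | exact Hl']. }
  assert (Hhalf : inD (1 / 2)%R) by (unfold inD; rewrite Cmod_R, Rabs_pos_eq; lra).
  assert (Hnz : forall n, ((1 / 2)%R ^ n * cexp (g (1 / 2)%R))%C <> 0).
  { intros n. apply Cmult_neq_0; [| apply cexp_neq_0].
    apply Cpow_nz, Cmod_gt_0. rewrite Cmod_R, Rabs_pos_eq; lra. }
  assert (Heig : forall n z, inD z ->
    Top m beta (fun z => z ^ n * cexp (g z))%C z = (m 0 * beta ^ n * (z ^ n * cexp (g z)))%C).
  { intros n z Hz. unfold Top. rewrite (Hexp z Hz), Em0, Cpow_mult_l.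
    pose proof (g1_cocycle beta z a m1 g Hb (Hser z Hz) (Hg z Hz) (Hg _ (Hrot z Hz))) as E.
    transitivity (beta ^ n * z ^ n * (cexp (m1 z) * cexp (g (beta * z))))%C; [ring |].
    rewrite E. ring. }
  assert (Hform : forall (f : CC -> CC) (lam z1 : CC), inD z1 -> f z1 <> 0 ->
    (forall z, inD z -> exists l, cdiff f z l) ->
    (forall z, inD z -> (lam * f z)%C = (cexp (m1 z) * f (beta * z))%C) ->
    exists (n : nat) (c : CC), lam = (m 0 * beta ^ n)%C /\
      forall z, inD z -> f z = (c * (z ^ n * cexp (g z)))%C).
  { intros f lam z1 Hz1 Hf1 Hf Heq.
    destruct (eigenfunction_form beta lam a m1 g f 1 z1) as (n & c & _ & E & Hform); try easy.
    exists n, c. now rewrite Em0. }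
  split.
  + intros lam. split.
    * intros Hps. destruct (Hdiff lam Hps) as (f & z1 & Hz1 & Hf1 & Hf & Heq).
      destruct (Hform f lam z1 Hz1 Hf1 Hf Heq) as (n & c & E & _). now exists n.
    * intros [n ->]. exists (fun z => z ^ n * cexp (g z))%C, (fun _ => RtoC 0).
      split; [apply Hhol | split].
      { apply Hol_cdiff. intros z _. exists (RtoC 0). apply cdiff_const. }
      split; [exists (RtoC (1 / 2)); split; [exact Hhalf | apply Hnz] |].
      intros z Hz. rewrite (Heig n z Hz). unfold Top. ring.
  + exists g. split; [intros z Hz; now apply Cpseries_cser, Hg |].
    intros n lam fn. split; [apply Hhol | split; [exists (RtoC (1 / 2)); split; [exact Hhalf | apply Hnz] | split]].
    { intros z Hz. now apply Heig. }
    intros f Hf Heq.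
    destruct (classic (exists z1, inD z1 /\ f z1 <> 0)) as [(z1 & Hz1 & Hf1) | Hno].
    * destruct (Hform f lam z1 Hz1 Hf1) as (k & c & E & Hfk).
      { now apply Hol_cdiff. }
      { intros z Hz. rewrite <- (Hexp z Hz). symmetry. now apply Heq. }
      (* As [m 0] is nonzero and the powers of [beta] are distinct, the eigenvalue determines the
         exponent; this makes the eigenspace one-dimensional. *)
      assert (Enk : n = k).
      { apply (rotation_pow_inj beta n k Hb).
        assert (Hm00 : m 0 <> 0) by now apply Hm0.
        transitivity (lam / m 0)%C; [unfold lam; field; easy |].
        rewrite E. field. easy. }
      exists c. intros z Hz. unfold fn. rewrite Enk. now apply Hfk.
    * exists (RtoC 0). intros z Hz. rewrite Cmult_0_l. apply NNPP. intros Hne.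
      apply Hno. now exists z.
- intros HL lam Hps.
  destruct (unbounded_of_LimSup a beta Hb HL) as (r0 & Hr0 & Hunb).
  destruct (Hdiff lam Hps) as (f & z1 & Hz1 & Hf1 & Hf & Heq).
  apply Hf1. now apply (no_eigenfunction beta lam z1 a m1 f r0).
Qed.
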